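(* Let $\delta$ be a diagram of size $n$, let $\lambda\vdash n$, and let $\mathcal G=(V,\sigma,E)$ be a connected component of the Assaf graph $\mathcal H_\delta$ which is a dual equivalence graph and satisfies $\mathcal G\cong\mathcal G_\lambda$. Then exactly one vertex of $V$ lies in $\mathrm{SYam}_\delta(\lambda)$, and $V\cap\mathrm{SYam}_\delta(\mu)=\emptyset$ for every partition $\mu\neq\lambda$.
   Context: Diagrams, row reading order, fillings, $T_\delta(w)$: a diagram is a finite $\delta\subset\mathbb Z\times\mathbb Z$ of cells $(x,y)$; cells are ordered in row reading order (rows top to bottom, each left to right) and numbered $1,\dots,|\delta|$; $T_\delta(w)$ is the filling of $\delta$ whose row reading word is $w$. Pistol starting at $c=(x,y)\in\delta$: the cells $(x',y)\in\delta$ with $x'\ge x$ together with the cells $(x',y-1)\in\delta$ with $x'\le x$. A set of indices (positions) is $\delta$-pistoled if the corresponding cells lie in a common pistol. Yamanouchi words: $\mathrm{Yam}(\lambda)$ is the set of words in which $i$ occurs $\lambda_i$ times and, read right to left, there are never more $i+1$'s than $i$'s so far. Such a $w$ of length $|\delta|$ jams $\delta$ if for some $i,j$ the positions of the $j$-th from last $i$ and the $(j+1)$-th from last $i+1$ are $\delta$-pistoled; $\mathrm{Yam}_\delta(\lambda)$ is the set of non-jamming ones. The standardization $\mathrm{st}(w)$ of a word of length $n$ replaces its $1$'s from left to right by $1,2,\dots,k$, then its $2$'s from left to right by $k+1,\dots$, etc. $\mathrm{SYam}_\delta(\lambda)=\{\mathrm{st}(w):w\in\mathrm{Yam}_\delta(\lambda)\}$.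 Signature: for $\pi\in S_n$, $\sigma(\pi)\in\{\pm1\}^{n-1}$ with $\sigma_i=+1$ iff $i$ precedes $i+1$ in $\pi$. Elementary dual equivalence $d_i$ ($1<i<n$) on $S_n$: $d_i(\dots i\dots i{-}1\dots i{+}1\dots)=(\dots i{+}1\dots i{-}1\dots i\dots)$, $d_i(\dots i{-}1\dots i{+}1\dots i\dots)=(\dots i\dots i{+}1\dots i{-}1\dots)$, identity if $i$ lies between $i-1$ and $i+1$. $\tilde d_i$: $\tilde d_i(\dots i\dots i{-}1\dots i{+}1\dots)=(\dots i{-}1\dots i{+}1\dots i\dots)$, $\tilde d_i(\dots i\dots i{+}1\dots i{-}1\dots)=(\dots i{+}1\dots i{-}1\dots i\dots)$, identity if $i$ lies between $i-1$ and $i+1$. For $|\delta|=n$, $D_i^\delta(\pi)=\tilde d_i(\pi)$ if the positions of $i-1,i,i+1$ in $\pi$ are $\delta$-pistoled, and $D_i^\delta(\pi)=d_i(\pi)$ otherwise. The Assaf graph $\mathcal H_\delta$ is the signed colored graph with vertex set $S_n$, signature $\sigma$, and for $2\le i\le n-1$ edge set $E_i=\{\{\pi,D_i^\delta(\pi)\}:D_i^\delta(\pi)\ne\pi\}$. A signed colored graph $(V,\sigma,E)$ has finite vertex set $V$, a signature map $\sigma:V\to\{\pm1\}^{n-1}$, and sets $E_i$ ($2\le i\le n-1$) of unordered pairs of distinct vertices (edges of color $i$). An isomorphism is a bijection on vertices which, with its inverse, preserves signatures and colored edges. For an integer interval $I$, the restriction $\mathcal G|_I$ has the same vertices, $\sigma'(v)_i=\sigma(v)_{\min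 I+i-1}$ for $1\le i\le|I|-1$ (when defined), and $E'_i=E_{\min I+i-1}$ for $2\le i\le|I|-1$ (when defined). For $\lambda\vdash n$ drawn in French notation (row $y\ge0$ has $\lambda_{y+1}$ left-justified cells), $\mathrm{SYT}(\lambda)$ is the set of standard fillings increasing along rows and up columns; $d_i$ acts on $T\in\mathrm{SYT}(\lambda)$ via its row reading word (giving again an element of $\mathrm{SYT}(\lambda)$). The standard dual equivalence graph $\mathcal G_\lambda$ has vertex set $\mathrm{SYT}(\lambda)$, signature $\sigma(\mathrm{rw}(T))$, and $E_i=\{\{T,d_i(T)\}:d_i(T)\ne T\}$. A signed colored graph is a dual equivalence graph if (Locally Standard) for every integer interval $I$ with $|I|=6$ each component of $\mathcal G|_I$ is isomorphic to some $\mathcal G_\lambda$, and (Commuting) whenever $\{v,w\}\in E_i$, $\{w,x\}\in E_j$ with $|i-j|>2$ there is $y$ with $\{v,y\}\in E_j$, $\{x,y\}\in E_i$. *)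

(* Defs.v *)
From HB Require Import structures.
From mathcomp Require Import all_boot order perm ssralg ssrnum ssrint finmap.

Set Implicit Arguments.
Unset Strict Implicit.
Unset Printing Implicit Defensive.

Local Open Scope nat_scope.

(** * Partitions *)

Definition is_part (la : seq nat) : bool := sorted geq la && (0 \notin la).

Definition part_of (n : nat) (la : seq nat) : bool :=
  is_part la && (sumn la == n).

(** * Diagrams and pistols *)

(* A cell is a pair (x, y) of abscissa and ordinate, with y pointing upwards. *)
Definition cell : choiceType := (int * int)%type.
Definition diagram := {fset cell}.

(* Row reading order: from the top row (largest y) down, left to right. *)
Definition row_order (c c' : cell) : bool :=
  ((c'.2 < c.2) || ((c.2 == c'.2) && (c.1 <= c'.1)))%R.

(* Position p, counted from 0, is that of the p-th cell of this sequence, and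
   of the p-th letter of a word; the cell numbered p in the usual 1-based
   numbering is thus at position p - 1. *)
Definition cells (delta : diagram) : seq delta :=
  sort (fun c c' => row_order (val c) (val c')) (enum {: delta}).

Definition pistol (delta : diagram) (c : delta) : pred delta := fun c' =>
  let: (x, y) := val c in let: (x', y') := val c' in
  (((y' == y) && (x <= x')) || ((y' == y - 1) && (x' <= x)))%R.

Definition pistoled (delta : diagram) (ps : seq nat) : bool :=
  [exists c : delta,
     all (fun p => has (fun c' => pistol c c' && (index c' (cells delta) == p))
                       (cells delta)) ps].

(** * Yamanouchi words and standardization *)

(* Letters are the positive integers; la_i is [nth 0 la i.-1]. *)
Definition Yam (la w : seq nat) : Prop :=
  [/\ 0 \notin w,
      forall i, 0 < i -> count_mem i w = nth 0 la i.-1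
    & forall i k, 0 < i -> count_mem i.+1 (drop k w) <= count_mem i (drop k w)].

(* Position in w of the j-th from last occurrence of a, for
   1 <= j <= count_mem a w. *)
Definition pos_from_last (w : seq nat) (a j : nat) : nat :=
  nth 0 (rev [seq p <- iota 0 (size w) | nth 0 w p == a]) j.-1.

Definition jams (delta : diagram) (w : seq nat) : Prop :=
  exists i j : nat,
    [/\ 0 < i, 0 < j, j <= count_mem i w, j.+1 <= count_mem i.+1 w
      & pistoled delta [:: pos_from_last w i j; pos_from_last w i.+1 j.+1]].

Definition Yam_diag (delta : diagram) (la w : seq nat) : Prop :=
  [/\ Yam la w, size w = #|` delta|%fset & ~ jams delta w].

(* The letter a at position p becomes the number of letters smaller than a,
   plus the number of a's at positions 0, ..., p. *)
Definition standardize (w : seq nat) : seq nat :=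
  [seq count (fun b => b < nth 0 w p) w + count_mem (nth 0 w p) (take p.+1 w)
     | p <- iota 0 (size w)].

Definition SYam (delta : diagram) (la u : seq nat) : Prop :=
  exists2 w, Yam_diag delta la w & u = standardize w.

(** * Elementary dual equivalences *)

(* Elements of S_n are handled through their one-line notation, a word in the
   letters 1, ..., n. *)
Definition one_line (n : nat) (s : 'S_n) : seq nat :=
  [seq (s p : nat).+1 | p <- enum 'I_n].

Definition subword3 (i : nat) (w : seq nat) : seq nat :=
  [seq a <- w | a \in [:: i.-1; i; i.+1]].

(* Replaces the letters i-1, i, i+1 of w, read from left to right, by the
   successive letters of u; the other letters stay in place. *)
Definition replace3 (i : nat) (w u : seq nat) : seq nat :=
  [seq if a \in [:: i.-1; i; i.+1] then nth a u (index a (subword3 i w)) else a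
     | a <- w].

(* Both operators are involutions, so each of the two defining exchanges is
   used in both directions. *)
Definition edual (i : nat) (w : seq nat) : seq nat :=
  let u := subword3 i w in
  if u == [:: i; i.-1; i.+1] then replace3 i w [:: i.+1; i.-1; i]
  else if u == [:: i.+1; i.-1; i] then replace3 i w [:: i; i.-1; i.+1]
  else if u == [:: i.-1; i.+1; i] then replace3 i w [:: i; i.+1; i.-1]
  else if u == [:: i; i.+1; i.-1] then replace3 i w [:: i.-1; i.+1; i]
  else w.

Definition edual_tilde (i : nat) (w : seq nat) : seq nat :=
  let u := subword3 i w in
  if u == [:: i; i.-1; i.+1] then replace3 i w [:: i.-1; i.+1; i]
  else if u == [:: i.-1; i.+1; i] then replace3 i w [:: i; i.-1; i.+1]
  else if u == [:: i; i.+1; i.-1] then replace3 i w [:: i.+1; i.-1; i]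
  else if u == [:: i.+1; i.-1; i] then replace3 i w [:: i; i.+1; i.-1]
  else w.

Definition edual_diag (delta : diagram) (i : nat) (w : seq nat) : seq nat :=
  if pistoled delta [:: index i.-1 w; index i w; index i.+1 w]
  then edual_tilde i w else edual i w.

(** * Signed colored graphs *)

(* [signature v] lists sigma(v)_1, ..., sigma(v)_(n-1), with [true] for +1 and
   [false] for -1. The edges of color i form a symmetric irreflexive relation,
   which is empty unless 2 <= i <= n - 1. *)
Record scgraph := SCGraph {
  degree : nat;
  vertex :> finType;
  signature : vertex -> degree.-1.-tuple bool;
  edge : nat -> rel vertex;
  edge_sym : forall i, symmetric (edge i);
  edge_irr : forall i, irreflexive (edge i);
  edge_color : forall i u v, edge i u v -> 2 <= i < degree
}.

Definition isomorphic (G H : scgraph) : Prop :=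
  exists2 f : G -> H, bijective f &
    (forall v, signature (f v) = signature v :> seq bool) /\
    (forall i u v, edge i (f u) (f v) = edge i u v).

Definition adjacent (G : scgraph) : rel G :=
  fun u v => [exists i : 'I_(degree G), edge i u v].

Definition is_component (G : scgraph) (V : {set G}) : Prop :=
  exists v, V = [set u | connect (@adjacent G) v u].

Section Induced.
Variables (G : scgraph) (V : {set G}).

Definition ivertex : finType := {v : G | v \in V}.
Definition isig (v : ivertex) := signature (val v).
Definition iedge (i : nat) : rel ivertex := fun u v => edge i (val u) (val v).

Fact iedge_sym i : symmetric (iedge i).
Proof. by move=> u v; apply: edge_sym. Qed.
Fact iedge_irr i : irreflexive (iedge i).
Proof. by move=> u; apply: edge_irr. Qed.
Fact iedge_color i u v : iedge i u v -> 2 <= i < degree G.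
Proof. exact: edge_color. Qed.

Definition induced : scgraph :=
  @SCGraph (degree G) ivertex isig iedge iedge_sym iedge_irr iedge_color.
End Induced.

(* The restriction to I = {a, ..., a + m - 1}, with 1 <= a and 1 <= m. The
   indices i for which sigma'_i is defined are those with 1 <= i <= m - 1 and
   a + i - 1 <= n - 1, whence the degree. *)
Section Restriction.
Variables (G : scgraph) (a m : nat).

Definition rdegree : nat := (minn m.-1 (degree G - a)).+1.
Definition rsig (v : G) : rdegree.-1.-tuple bool :=
  [tuple nth false (signature v) (a.-1 + i) | i < rdegree.-1].
Definition redge (i : nat) : rel G :=
  fun u v => (2 <= i < rdegree) && edge (a + i).-1 u v.

Fact redge_sym i : symmetric (redge i).
Proof. by move=> u v; rewrite /redge edge_sym. Qed.
Fact redge_irr i : irreflexive (redge i).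
Proof. by move=> u; rewrite /redge edge_irr andbF. Qed.
Fact redge_color i u v : redge i u v -> 2 <= i < rdegree.
Proof. by case/andP. Qed.

Definition restriction : scgraph :=
  @SCGraph rdegree G rsig redge redge_sym redge_irr redge_color.
End Restriction.

(* The graph on objects V with reading words [rd], signature the signature of
   the reading word, and E_i = { {v, f_i v} : f_i v != v }, where f_i acts on
   V through reading words. *)
Section WordGraph.
Variables (n : nat) (V : finType) (rd : V -> seq nat).
Variable f : nat -> seq nat -> seq nat.

Definition wsig (v : V) : n.-1.-tuple bool :=
  [tuple index i.+1 (rd v) < index i.+2 (rd v) | i < n.-1].
Definition wedge (i : nat) : rel V := fun u v =>
  [&& 2 <= i < n, u != v & (f i (rd u) == rd v) || (f i (rd v) == rd u)].

Fact wedge_sym i : symmetric (wedge i).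
Proof. by move=> u v; rewrite /wedge eq_sym orbC. Qed.
Fact wedge_irr i : irreflexive (wedge i).
Proof. by move=> u; rewrite /wedge eqxx andbF. Qed.
Fact wedge_color i u v : wedge i u v -> 2 <= i < n.
Proof. by case/andP. Qed.

Definition word_graph : scgraph :=
  @SCGraph n V wsig wedge wedge_sym wedge_irr wedge_color.
End WordGraph.

Definition assaf_graph (delta : diagram) : scgraph :=
  word_graph #|` delta|%fset (@one_line #|` delta|%fset) (edual_diag delta).

(** * Standard dual equivalence graphs *)

(* French notation: row y >= 0 has the cells (x, y) with 0 <= x < la_(y+1). *)
Definition young_diagram (la : seq nat) : diagram :=
  [fset c in [seq (Posz x, Posz y) : cell
                | y <- iota 0 (size la), x <- iota 0 (nth 0 la y)]]%fset.

(* The bound on the entries only serves to make the type finite. *)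
Definition filling (la : seq nat) := {ffun young_diagram la -> 'I_(sumn la).+1}.

Definition reading_word (la : seq nat) (T : filling la) : seq nat :=
  [seq (T c : nat) | c <- cells (young_diagram la)].

Definition is_SYT (la : seq nat) (T : filling la) : bool :=
  [&& perm_eq (reading_word T) (iota 1 (sumn la)),
      [forall c, forall c',
         [&& (val c).2 == (val c').2 & ((val c).1 < (val c').1)%R]
           ==> (T c < T c')]
    & [forall c, forall c',
         [&& (val c).1 == (val c').1 & ((val c).2 < (val c').2)%R]
           ==> (T c < T c')]].

Definition SYT (la : seq nat) : finType := {T : filling la | is_SYT T}.

Definition standard_graph (la : seq nat) : scgraph :=
  word_graph (sumn la) (fun T : SYT la => reading_word (val T)) edual.

(** * Dual equivalence graphs *)

Definition locally_standard (G : scgraph) : Prop :=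
  forall a, 0 < a -> forall C, is_component (G := restriction G a 6) C ->
  exists2 la, is_part la & isomorphic (induced C) (standard_graph la).

Definition commuting (G : scgraph) : Prop :=
  forall i j (v w x : G), (i + 2 < j) || (j + 2 < i) ->
  edge i v w -> edge j w x -> exists2 y, edge j v y & edge i x y.

Definition dual_equivalence_graph (G : scgraph) : Prop :=
  locally_standard G /\ commuting G.

(* Main.v *)
Require Import Defs.
From HB Require Import structures.
From mathcomp Require Import all_boot order perm ssralg ssrnum ssrint finmap.
From mathcomp Require Import zify.

(* Record a permutation by the list of the positions of 1, 2, ..., n. On this
   list D_i acts on three consecutive entries a, b, c: d_i swaps two of them when
   the third lies between, and the rotation replaces the swap when the interval
   that they span is pistoled. Two consecutive colors give the same non-trivial
   edge only when both swap the two entries they share, which forces these two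
   to span a non-pistoled interval containing the other two. Let t be the last m
   positions of the letter i in w and y the m positions of the letter i + 1. The
   Yamanouchi and non-jamming conditions say that y_r < t_r and that y_r, t_(r+1)
   are not pistoled. They hold if and only if a fixed sequence of colors, which
   turns the block t y into t_1 y_1 t_2 y_2 ... by swaps when they do hold, ends
   at a vertex where suitable signs are prescribed and suitable edges coincide.
   Such a condition is invariant under isomorphism, and in the standard graph,
   where nothing is pistoled, it singles out the superstandard tableau. *)

Set Implicit Arguments.
Unset Strict Implicit.
Unset Printing Implicit Defensive.

Local Open Scope nat_scope.

(** * Moves on lists of positions *)

(** Here [a], [b], [c] are the positions of i-1, i, i+1. A swap keeps the median entry in place and
    exchanges the extremes; with [rot], a rotation carries the median to the other end of the
    triple. *)
Definition kmove (rot : bool) (a b c : nat) : seq nat :=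
  if (b < a < c) || (c < a < b) then
    if rot then [:: b; c; a] else [:: a; c; b]
  else if (b < c < a) || (a < c < b) then
    if rot then [:: c; a; b] else [:: b; a; c]
  else [:: a; b; c].

(** The entry of index a - 1 is the position of the label a, so color [i] acts on the three entries
    from index [i - 2] on. *)
Definition dmove (P : pred (seq nat)) (i : nat) (q : seq nat) : seq nat :=
  if drop (i - 2) q is [:: a, b, c & r] then
    take (i - 2) q ++ kmove (P [:: a; b; c]) a b c ++ r
  else q.

(** Lists stand for sets of positions: this closure makes [P] blind to order and repetition. *)
Definition subset_closed (P : pred (seq nat)) : Prop :=
  forall s s', {subset s' <= s} -> P s -> P s'.

Definition convex (P : pred (seq nat)) : Prop :=
  forall a b c, a < b < c -> P [:: a; c] -> P [:: a; b; c].

Lemma dmove_cat P pre a b c r :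
  dmove P (size pre).+2 (pre ++ [:: a, b, c & r]) =
  pre ++ kmove (P [:: a; b; c]) a b c ++ r.
Proof.
by rewrite /dmove subSS subSS subn0 drop_size_cat // take_size_cat.
Qed.

Lemma dmove_short P i q : 1 < i -> size q <= i -> dmove P i q = q.
Proof.
move=> i1 h; rewrite /dmove.
have: size (drop (i - 2) q) < 3 by rewrite size_drop; lia.
by case: drop => [|a [|b [|c r]]].
Qed.

Lemma split3 (i : nat) (q : seq nat) : i.+2 < size q ->
  exists a b c r, q = take i q ++ [:: a, b, c & r].
Proof.
move=> h; exists (nth 0 q i), (nth 0 q i.+1), (nth 0 q i.+2), (drop i.+3 q).
by rewrite -!drop_nth ?cat_take_drop //; lia.
Qed.

Section Moves.
Variable P : pred (seq nat).
Hypothesis subP : subset_closed P.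
Hypothesis convP : convex P.

Lemma subP_eq s s' : s =i s' -> P s = P s'.
Proof.
by move=> e; apply/idP/idP; apply: subP => x; rewrite e.
Qed.

Lemma P_middle a b c : (b < a < c) || (c < a < b) -> P [:: a; b; c] = P [:: b; c].
Proof.
move=> h; apply/idP/idP.
  by apply: subP => x; rewrite !inE => /orP[] ->; rewrite ?orbT.
case/orP: h => h.
  by move=> /(convP h); apply: subP => x; rewrite !inE => /or3P[] ->; rewrite ?orbT.
move=> h2; apply: (subP _ (convP h _)); last by apply: subP h2 => x; rewrite !inE orbC.
by move=> x; rewrite !inE => /or3P[] ->; rewrite ?orbT.
Qed.

Lemma P_shrink a b c d : a <= b < d -> d <= c -> P [:: a; c] -> P [:: b; d].
Proof.
move=> hb hd h.
have: P [:: b; c].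
  have [->|ne] := eqVneq b a; first by [].
  have hh : a < b < c by lia.
  by apply: subP (convP hh h) => x; rewrite !inE => /orP[] ->; rewrite ?orbT.
have [->|ne] := eqVneq d c; first by [].
move=> h2; have hh : b < d < c by lia.
by apply: subP (convP hh h2) => x; rewrite !inE => /orP[] ->; rewrite ?orbT.
Qed.

(** A swap leaves the median where it was, so repeating it undoes it. A rotation carries the median
    from the first place to the last or back, where the opposite rotation applies. The set of three
    positions, hence the value of [P], stays the same. *)
Lemma dmoveK i : 1 < i -> involutive (dmove P i).
Proof.
case: i => [|[|i]] // _ q.
have [h|h] := ltnP i.+2 (size q); last by rewrite !dmove_short.
have [a [b [c [r e]]]] := split3 h.
have si : i = size (take i q) by rewrite size_take; case: ltnP; lia.
rewrite e; move: (take i q) si => pre -> {h e}.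
rewrite dmove_cat /kmove.
have P1 : P [:: a; c; b] = P [:: a; b; c].
  by apply: subP_eq => x; rewrite !inE; do !case: eqP.
have P2 : P [:: b; c; a] = P [:: a; b; c].
  by apply: subP_eq => x; rewrite !inE; do !case: eqP.
have P3 : P [:: b; a; c] = P [:: a; b; c].
  by apply: subP_eq => x; rewrite !inE; do !case: eqP.
have P4 : P [:: c; a; b] = P [:: a; b; c].
  by apply: subP_eq => x; rewrite !inE; do !case: eqP.
case: ifP => h1; [|case: ifP => h2]; last by rewrite dmove_cat /kmove h1 h2.
  case: ifP => hP; rewrite dmove_cat /kmove ?P1 ?P2 hP.
    by rewrite ifF ?ifT //; lia.
  by rewrite ifT //; lia.
case: ifP => hP; rewrite dmove_cat /kmove ?P3 ?P4 hP.
  by rewrite ifT //; lia.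
by rewrite ifF ?ifT //; lia.
Qed.

End Moves.

(** * Interleaving two blocks by moves *)

Definition good (P : pred (seq nat)) (t ys : seq nat) : Prop :=
  [/\ sorted ltn t, sorted ltn ys,
      forall r, r < size t -> nth 0 ys r < nth 0 t r
    & forall r, r.+1 < size t -> ~~ P [:: nth 0 ys r; nth 0 t r.+1]].

Fixpoint mix (t ys : seq nat) : seq nat :=
  match t, ys with
  | x :: t', y :: ys' => [:: x, y & mix t' ys']
  | _, _ => [::]
  end.

(** For good blocks [t ys] starting at index [k], each color swaps the last two of its three
    entries: the first run brings the head of [ys] leftwards to just after the head of [t], and the
    recursion treats the rest, from index [k.+2] on. *)
Fixpoint mix_colors (k m : nat) : seq nat :=
  if m is m'.+1 then rev (iota k.+2 m') ++ mix_colors k.+2 m' else [::].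

Lemma size_mix t ys : size t = size ys -> size (mix t ys) = size t + size ys.
Proof.
elim: t ys => [|x t IH] [|y ys] //= [e]; rewrite IH //; lia.
Qed.

Lemma nth_mix t ys r : size t = size ys -> r < size t ->
  nth 0 (mix t ys) r.*2 = nth 0 t r /\ nth 0 (mix t ys) r.*2.+1 = nth 0 ys r.
Proof.
elim: t ys r => [|x t IH] [|y ys] [|r] //= [e] h.
by have [] := IH ys r e h.
Qed.

Lemma unmix q m : size q = m.*2 ->
  exists t ys, [/\ size t = m, size ys = m & q = mix t ys].
Proof.
elim: m q => [|m IH] [|x [|y q]] //=; first by exists [::], [::].
move=> [h]; have [t [ys [st sy ->]]] := IH q h.
by exists (x :: t), (y :: ys); rewrite /= st sy.
Qed.

Lemma mix_colorsP k m c : c \in mix_colors k m -> k.+1 < c < k + m.*2.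
Proof.
elim: m k => [|m IH] k //=; rewrite mem_cat mem_rev mem_iota => /orP[|/IH]; lia.
Qed.

Definition dmoves (P : pred (seq nat)) : seq nat -> seq nat -> seq nat :=
  foldl (fun q c => dmove P c q).

Section MixMoves.
Variable P : pred (seq nat).
Hypothesis subP : subset_closed P.
Hypothesis convP : convex P.

(* The entry before z is a witness between y and z, so y and z can be swapped. *)
Lemma dmoves_push pre x t y post :
  sorted ltn (x :: t) -> y < x -> {in t, forall z, ~~ P [:: y; z]} ->
  dmoves P (pre ++ x :: t ++ y :: post) (rev (iota (size pre).+2 (size t))) =
  pre ++ [:: x, y & t ++ post].
Proof.
(* [y] meets the last entry of [t] first, so the induction removes entries of [t] from the right. *)
elim/last_ind: t post => [|t z IH] post //.
move=> srt yx hP.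
rewrite size_rcons -[(size t).+1]addn1 iotaD rev_cat /= cat_rcons.
have -> : pre ++ [:: x & t ++ [:: z, y & post]] =
  (pre ++ belast x t) ++ [:: last x t, z, y & post].
  by rewrite -cat_cons lastI -cats1 -!catA.
have sz : (size pre).+2 + size t = (size (pre ++ belast x t)).+2.
  by rewrite size_cat size_belast; lia.
rewrite /dmoves /= sz dmove_cat.
have yl : y < last x t < z.
  move: srt; rewrite -rcons_cons /= rcons_path => /andP[pt lz]; apply/andP; split=> //.
  by have:= order_path_min ltn_trans pt; case/lastP: (t) => //= t' l;
     rewrite last_rcons all_rcons => /andP[h _]; apply: ltn_trans h.
have nP : P [:: last x t; z; y] = false.
  rewrite (P_middle subP convP); last by rewrite yl orbT.
  apply/negbTE; rewrite (subP_eq subP (s' := [:: y; z])); last first.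
    by move=> u; rewrite !inE orbC.
  by apply: hP; rewrite mem_rcons inE eqxx.
rewrite nP /kmove yl orbT.
have -> : (pre ++ belast x t) ++ [:: last x t; y; z] ++ post =
  pre ++ x :: t ++ y :: (z :: post).
  by rewrite -[in RHS]cat_cons (lastI x t) -cats1 -!catA.
rewrite [foldl _ _ _]IH //; first by rewrite cat_rcons.
  by move: srt; rewrite -rcons_cons; case/lastP: {+}t => //= ? ?;
    rewrite !rcons_path => /andP[].
by move=> u hu; apply: hP; rewrite mem_rcons inE hu orbT.
Qed.

Lemma good_cons x t y ys : good P (x :: t) (y :: ys) -> good P t ys.
Proof.
move=> [s1 s2 h3 h4]; split.
- exact: path_sorted s1.
- exact: path_sorted s2.
- by move=> r hr; apply: (h3 r.+1).
- by move=> r hr; apply: (h4 r.+1).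
Qed.

Lemma dmoves_mix pre t ys post : size t = size ys -> good P t ys ->
  dmoves P (pre ++ t ++ ys ++ post) (mix_colors (size pre) (size t)) =
  pre ++ mix t ys ++ post.
Proof.
elim: t ys pre => [|x t IH] [|y ys] pre //= [e] g.
have [s1 s2 h3 h4] := g.
rewrite /dmoves foldl_cat [foldl _ _ (rev _)]dmoves_push //; last 2 first.
- exact: (h3 0).
(* [good] speaks only of the first entry of [t]; a pistoled pair [y], [z] with a larger [z] would
   shrink to that one. *)
- move=> z zt.
  have /andP[xt _] : (x < z) && true by rewrite (allP (order_path_min ltn_trans s1)).
  case: t s1 {IH e g} h3 h4 zt xt => // x' t /= /andP[xx' pt] h3 h4 zt xt.
  apply/negP => hP; have /= /negP[] := h4 0 isT.
  apply: (P_shrink subP convP _ _ hP).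
    have: (y < nth 0 (x :: x' :: t) 0) by apply: (h3 0).
    by move=> /=; lia.
  by move: zt;
    rewrite inE => /orP[/eqP->//|/(allP (order_path_min ltn_trans pt)) /ltnW].
have -> : pre ++ [:: x, y & t ++ ys ++ post] = (pre ++ [:: x; y]) ++ t ++ ys ++ post.
  by rewrite -catA.
have -> : (size pre).+2 = size (pre ++ [:: x; y]) by rewrite size_cat addn2.
by rewrite [foldl _ _ _]IH //; [rewrite -catA|exact: good_cons g].
Qed.

Lemma dmovesK q cs : all (ltn 1) cs -> dmoves P (dmoves P q cs) (rev cs) = q.
Proof.
elim: cs q => [|c cs IH] q //= /andP[hc hcs].
by rewrite rev_cons -cats1 /dmoves foldl_cat [foldl _ _ (rev _)]IH //= dmoveK.
Qed.

Lemma dmoves_inj cs : all (ltn 1) cs -> injective (dmoves P ^~ cs).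
Proof. by move=> h q q' /= e; rewrite -(dmovesK q h) e dmovesK. Qed.

(* The moves of two successive colors coincide and are not trivial only if they
   both swap the two entries B, C that they share. *)
Lemma dmove_coincide pre A B C D post :
  let q := pre ++ [:: A, B, C, D & post] in
  let i := (size pre).+2 in
  (dmove P i q = dmove P i.+1 q) /\ dmove P i q <> q ->
  [/\ (B < A < C) || (C < A < B), (B < D < C) || (C < D < B) & ~~ P [:: B; C]].
Proof.
move=> q i; rewrite /q /i dmove_cat.
have -> : (size pre).+3 = (size (pre ++ [:: A])).+2 by rewrite size_cat addn1.
have -> : pre ++ [:: A, B, C, D & post] = (pre ++ [:: A]) ++ [:: B, C, D & post].
  by rewrite -catA.
rewrite dmove_cat -!catA /= => -[/eqP].
rewrite eqseq_cat // eqxx /= => /eqP e ne.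
have {ne} : kmove (P [:: A; B; C]) A B C <> [:: A; B; C].
  by move=> ek; case: ne; rewrite ek.
move: e; rewrite {1 3}/kmove.
have [h1|/negP h1] := boolP ((B < A < C) || (C < A < B)).
  rewrite (P_middle subP convP h1).
  (* A rotation would replace the entry [A], which the next color does not touch. *)
  case: (P _); first by rewrite /kmove; repeat case: ifP => ?; move=> /eqP + _;
    rewrite /= !eqseq_cons; lia.
  rewrite /kmove => + _; have [//|/negP h2] := boolP ((B < D < C) || (C < D < B)).
  by move=> e; move/eqP: e; repeat case: ifP => ?; rewrite /= !eqseq_cons; lia.
(* If [A] is not the median, a non-trivial first move again changes the entry [A]. *)
by repeat case: ifP => ?; rewrite /kmove; repeat case: ifP => ?; move=> /eqP e /eqP;
  move: e; rewrite /= !eqseq_cons ?eqxx; lia.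
Qed.

(** Both moves are the same swap of [B] and [C], with witness [A] for the first color and [D] for
    the second. *)
Lemma coincide_dmove pre A B C D post :
  let q := pre ++ [:: A, B, C, D & post] in
  let i := (size pre).+2 in
  B < A < C -> B < D < C -> ~~ P [:: B; C] ->
  dmove P i q = dmove P i.+1 q /\ dmove P i q <> q.
Proof.
move=> q i hA hD hP; rewrite /q /i dmove_cat.
have -> : (size pre).+3 = (size (pre ++ [:: A])).+2 by rewrite size_cat addn1.
have -> : pre ++ [:: A, B, C, D & post] = (pre ++ [:: A]) ++ [:: B, C, D & post].
  by rewrite -catA.
rewrite dmove_cat (P_middle subP convP) ?hA // (negbTE hP).
have -> : P [:: B; C; D] = false.
  rewrite (subP_eq subP (s' := [:: D; B;
    C])) ?(P_middle subP convP) ?hD ?(negbTE hP) //.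
  by move=> x; rewrite !inE; do !case: eqP.
rewrite /kmove hA hD /= orbT ifF; last by lia.
by rewrite -!catA; split=> // /eqP; rewrite eqseq_cat // eqxx /= => /eqP[]; lia.
Qed.

End MixMoves.

(** * An isomorphism-invariant form of the Yamanouchi condition *)

(** The graph form of D_c: the other end of the edge of color [c], or the vertex itself where there
    is none. *)
Definition partner (G : scgraph) (c : nat) (u v : G) : Prop :=
  edge c u v \/ u = v /\ forall z, ~~ edge c u z.

Fixpoint walk (G : scgraph) (cs : seq nat) (u v : G) : Prop :=
  if cs is c :: cs' then exists2 w, partner c u w & walk cs' w v else u = v.

(* This mentions only the signature and the edges, so isomorphisms preserve it;
   [mixableP] reads it off the positions of the labels. *)
Definition mixable (G : scgraph) (k m : nat) (v : G) : Prop :=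
  exists2 u, walk (mix_colors k m) v u &
    (forall r, r < m -> ~~ nth false (signature u) (k + r.*2)) /\
    (forall r, r.+1 < m -> nth false (signature u) (k + r.*2).+1 /\
       exists2 u', edge (k + r.*2).+2 u u' & edge (k + r.*2).+3 u u').

Section Isomorphism.
Variables (G H : scgraph) (f : G -> H).
Hypothesis bij_f : bijective f.
Hypothesis sig_f : forall v, signature (f v) = signature v :> seq bool.
Hypothesis edge_f : forall i u v, edge i (f u) (f v) = edge i u v.

Lemma partner_iso c u v : partner c u v -> partner c (f u) (f v).
Proof.
case: bij_f => g fK gK [e|[-> n]]; first by left; rewrite edge_f.
by right; split=> // z; rewrite -[z]gK edge_f.
Qed.

Lemma walk_iso cs u v : walk cs u v -> walk cs (f u) (f v).
Proof.
elim: cs u => [|c cs IH] u /=; first by move->.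
by case=> w pw ww; exists (f w); [apply: partner_iso|apply: IH].
Qed.

Lemma mixable_iso k m v : mixable k m v -> mixable k m (f v).
Proof.
case=> u wu [h1 h2]; exists (f u); first exact: walk_iso.
rewrite sig_f; split=> // r hr; have [h3 [u' e1 e2]] := h2 r hr.
by split=> //; exists (f u'); rewrite edge_f.
Qed.

End Isomorphism.

(** The description shared by a component of the Assaf graph and by the standard graph: [L v] lists
    the positions of the labels and the edges are the non-trivial moves. [model_closed] lets any
    sequence of moves be followed inside the graph. *)
Record model (P : pred (seq nat)) (G : scgraph) (L : G -> seq nat) : Prop := {
  model_inj : injective L;
  model_uniq : forall v, uniq (L v);
  model_size : forall v, size (L v) = degree G;
  model_sig : forall v i, i.+1 < degree G ->
    nth false (signature v) i = (nth 0 (L v) i < nth 0 (L v) i.+1);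
  model_edge : forall i u v,
    edge i u v = [&& 2 <= i < degree G, u != v & L v == dmove P i (L u)];
  model_closed : forall v i, 2 <= i < degree G ->
    exists u, L u = dmove P i (L v)
}.

Lemma split4 (i : nat) (q : seq nat) : i.+3 < size q ->
  q = take i q ++ [:: nth 0 q i, nth 0 q i.+1, nth 0 q i.+2, nth 0 q i.+3
                    & drop i.+4 q].
Proof.
move=> h; rewrite -[LHS](cat_take_drop i).
do 4 (rewrite (drop_nth 0); last by lia); done.
Qed.

Section Coincidence.
Variable P : pred (seq nat).
Hypothesis subP : subset_closed P.
Hypothesis convP : convex P.
Variables (q : seq nat) (i : nat).
Hypothesis size_q : i.+3 < size q.
Local Notation A := (nth 0 q i).
Local Notation B := (nth 0 q i.+1).
Local Notation C := (nth 0 q i.+2).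
Local Notation D := (nth 0 q i.+3).

Lemma dmove_coincide_nth :
  dmove P i.+2 q = dmove P i.+3 q -> dmove P i.+2 q <> q ->
  [/\ (B < A < C) || (C < A < B), (B < D < C) || (C < D < B) & ~~ P [:: B; C]].
Proof.
move=> e1 e2.
have szp : size (take i q) = i by rewrite size_takel //; lia.
have := @dmove_coincide P subP convP (take i q) A B C D (drop i.+4 q).
by rewrite -split4 // szp; apply.
Qed.

Lemma coincide_dmove_nth : B < A < C -> B < D < C -> ~~ P [:: B; C] ->
  dmove P i.+2 q = dmove P i.+3 q /\ dmove P i.+2 q <> q.
Proof.
move=> hA hD hP.
have szp : size (take i q) = i by rewrite size_takel //; lia.
have := @coincide_dmove P subP convP (take i q) A B C D (drop i.+4 q).
by rewrite -split4 // szp; apply.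
Qed.

End Coincidence.

Section Model.
Variables (P : pred (seq nat)) (G : scgraph) (L : G -> seq nat).
Hypothesis subP : subset_closed P.
Hypothesis convP : convex P.
Hypothesis mL : model P L.

Lemma partnerP c u v : 2 <= c < degree G ->
  partner c u v <-> L v = dmove P c (L u).
Proof.
move=> hc; rewrite /partner (model_edge mL) hc /=; split.
  case=> [/andP[_ /eqP] //|[<- n]].
  have [z hz] := model_closed mL u hc.
  by have := n z; rewrite (model_edge mL) hc hz eqxx andbT /= negbK => /eqP e;
    rewrite {1}e.
move=> e; have [uv|uv] := eqVneq u v; last by left; rewrite e eqxx.
right; split=> // z; rewrite (model_edge mL) hc /= -e -uv.
by rewrite (inj_eq (model_inj mL)) eq_sym andNb.
Qed.

Lemma walkP cs u v : all (fun c => 2 <= c < degree G) cs ->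
  walk cs u v <-> L v = dmoves P (L u) cs.
Proof.
elim: cs u => [|c cs IH] u /=.
  by move=> _; split=> [->//|/(model_inj mL) ->].
move=> /andP[hc hcs]; split.
  by case=> w /(partnerP _ _ hc) e /(IH _ hcs) ->; rewrite e.
move=> e; have [w hw] := model_closed mL u hc.
by exists w; [apply/partnerP|apply/IH=> //; rewrite hw].
Qed.

Lemma closed_walk cs v : all (fun c => 2 <= c < degree G) cs ->
  exists u, L u = dmoves P (L v) cs.
Proof.
elim: cs v => [|c cs IH] v /=; first by exists v.
move=> /andP[hc hcs]; have [w hw] := model_closed mL v hc.
by have [u hu] := IH w hcs; exists u; rewrite hu hw.
Qed.

(** Cut into pairs from index [k] on, the list at the end of the walk has the form [mix t ys]. The
    signs and coinciding edges required there make [t] and [ys] good. Injectivity of the moves then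
    identifies the initial blocks, whatever the walk does on the way. *)
Lemma mixableP k m v : k + m.*2 <= degree G ->
  mixable k m v <->
  good P (take m (drop k (L v))) (take m (drop (k + m) (L v))).
Proof.
move=> hkm.
have colors : all (fun c => 2 <= c < degree G) (mix_colors k m).
  by apply/allP => c /mix_colorsP; lia.
have colors1 : all (ltn 1) (mix_colors k m).
  by apply: sub_all colors => c /andP[].
have sL w : size (take k (L w)) = k.
  by rewrite size_takel // (model_size mL); lia.
have nthu u t ys post : L u = take k (L u) ++ mix t ys ++ post ->
    size t = m -> size ys = m -> forall r, r < m ->
    nth 0 (L u) (k + r.*2) = nth 0 t r /\ nth 0 (L u) (k + r.*2).+1 = nth 0 ys r.
  move=> e st sy r hr; rewrite -addnS e.
  rewrite !nth_cat sL !(ltnNge _ k) !leq_addr /= !addKn.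
  have [sm m1] : size (mix t ys) = m.*2 /\ r < size t by rewrite size_mix; lia.
  by rewrite !ifT; try lia; apply: nth_mix; rewrite ?st.
split.
  case=> u /walkP -/(_ colors) wu [h1 h2].
  pose M := take m.*2 (drop k (L u)).
  have sM : size M = m.*2 by rewrite size_takel // size_drop (model_size mL); lia.
  have [t [ys [st sy eM]]] := unmix sM.
  have eu : L u = take k (L u) ++ mix t ys ++ drop (k + m.*2) (L u).
    by rewrite -eM addnC -drop_drop cat_take_drop cat_take_drop.
  have nu := nthu u t ys _ eu st sy.
  have nu1 r : r.+1 < m ->
      nth 0 (L u) (k + r.*2).+2 = nth 0 t r.+1 /\
      nth 0 (L u) (k + r.*2).+3 = nth 0 ys r.+1.
    by move=> /nu; rewrite doubleS !addnS.
  (* The four entries from index [k + r.*2] on are t_r, y_r, t_(r+1), y_(r+1); the positive sign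
     fixes the orientation y_r < t_(r+1). *)
  have test r : r.+1 < m ->
      [/\ nth 0 ys r < nth 0 t r < nth 0 t r.+1,
          nth 0 ys r < nth 0 ys r.+1 < nth 0 t r.+1
        & ~~ P [:: nth 0 ys r; nth 0 t r.+1]].
    move=> hr; have [pos [u' e1 e2]] := h2 r hr.
    have [n0 n1] := nu r (ltnW hr); have [n2 n3] := nu1 r hr.
    move: pos; rewrite (model_sig mL) ?n1 ?n2; last by lia.
    move=> pos.
    have szq : (k + r.*2).+3 < size (L u) by rewrite (model_size mL); lia.
    move: e1 e2; rewrite !(model_edge mL).
    move=> /and3P[_ ne /eqP e1] /and3P[_ _ /eqP e2].
    have := dmove_coincide_nth subP convP szq.
    rewrite n0 n1 n2 n3 -e1 -e2; case=> //.
      by move/(model_inj mL)/esym/eqP; apply/negP.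
    by move=> h3 h4 h5; split=> //; lia.
  have gd : good P t ys.
    split.
    - by apply/(sortedP 0) => i; rewrite st => /test[/andP[]].
    - by apply/(sortedP 0) => i; rewrite sy => /test[_ /andP[]].
    - move=> r; rewrite st => hr; have := h1 r hr; have [n0 n1] := nu r hr.
      rewrite (model_sig mL) ?n0 ?n1; last by lia.
      (* For the last index only the negative sign is available; equality is excluded because
         positions are distinct. *)
      have [lt|] := ltnP r.+1 m; first by have [/andP[]] := test r lt.
      move=> _; rewrite -leqNgt leq_eqVlt => /orP[|//].
      rewrite -n0 -n1 nth_uniq ?(model_uniq mL) // ?(model_size mL); lia.
    - by move=> r; rewrite st => /test[].
  (* Starting from the good blocks [t] and [ys], the same colors end at this very list, so by
     injectivity these are the blocks of [L v]. *)
  have := dmoves_mix subP convP (take k (L u)) (drop (k + m.*2) (L u)) (etrans st (esym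
    sy)) gd.
  rewrite -eu sL st [RHS]wu => /(dmoves_inj subP colors1) <-.
  rewrite drop_size_cat ?sL // take_size_cat // catA drop_size_cat ?size_cat ?sL ?st //.
  by rewrite take_size_cat.
move=> gd; set t := take m _ in gd; set ys := take m _ in gd.
have st : size t = m by rewrite size_takel // size_drop (model_size mL); lia.
have sy : size ys = m by rewrite size_takel // size_drop (model_size mL); lia.
have [u hu] := closed_walk v colors.
have ev : L v = take k (L v) ++ t ++ ys ++ drop (k + m.*2) (L v).
  rewrite -addnn addnA addnC -drop_drop cat_take_drop.
  by rewrite [k + m]addnC -drop_drop !cat_take_drop.
have eu : L u = take k (L v) ++ mix t ys ++ drop (k + m.*2) (L v).
  by rewrite -(dmoves_mix subP convP _ _ (etrans st (esym sy)) gd) sL st -ev.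
have ek : take k (L u) = take k (L v) by rewrite eu take_size_cat.
rewrite -ek in eu.
have nu := nthu u t ys _ eu st sy.
have nu1 r : r.+1 < m ->
    nth 0 (L u) (k + r.*2).+2 = nth 0 t r.+1 /\
    nth 0 (L u) (k + r.*2).+3 = nth 0 ys r.+1.
  by move=> /nu; rewrite doubleS !addnS.
have [s1 s2 g3 g4] := gd; rewrite st in g3 g4.
exists u; first exact/walkP.
split=> r hr.
  have [n0 n1] := nu r hr; rewrite (model_sig mL) ?n0 ?n1; last by lia.
  by rewrite -leqNgt ltnW // g3.
have [n0 n1] := nu r (ltnW hr); have [n2 n3] := nu1 r hr.
have hA : nth 0 ys r < nth 0 t r < nth 0 t r.+1.
  by rewrite g3 ?(ltnW hr) //=; move/(sortedP 0): s1; apply; rewrite st.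
have hD : nth 0 ys r < nth 0 ys r.+1 < nth 0 t r.+1.
  by rewrite g3 // andbT; move/(sortedP 0): s2; apply; rewrite sy.
split.
  by rewrite (model_sig mL) ?n1 ?n2; lia.
have szq : (k + r.*2).+3 < size (L u) by rewrite (model_size mL); lia.
have [||| e1 e2] := coincide_dmove_nth subP convP szq.
- by rewrite n0 n1 n2.
- by rewrite n1 n2 n3.
- by rewrite n1 n2 g4.
have hc : 2 <= (k + r.*2).+2 < degree G by lia.
have [u' hu'] := model_closed mL u hc.
have ne : u != u' by apply/eqP => uu; rewrite -hu' uu in e2.
exists u'; rewrite (model_edge mL) ne ?hu' ?eqxx ?e1 ?eqxx; lia.
Qed.

End Model.

(** * Permutation words *)

(** For a permutation word, the inverse permutation with values counted from 0. *)
Definition positions (w : seq nat) : seq nat :=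
  [seq index a w | a <- iota 1 (size w)].

Definition perm_word (n : nat) (w : seq nat) : bool := perm_eq w (iota 1 n).

Lemma perm_word_size n w : perm_word n w -> size w = n.
Proof. by move/perm_size; rewrite size_iota. Qed.

Lemma perm_word_uniq n w : perm_word n w -> uniq w.
Proof. by move/perm_uniq ->; rewrite iota_uniq. Qed.

Lemma perm_word_mem n w a : perm_word n w -> (a \in w) = (0 < a <= n).
Proof. by move/perm_mem ->; rewrite mem_iota add1n ltnS. Qed.

Lemma size_positions w : size (positions w) = size w.
Proof. by rewrite size_map size_iota. Qed.

Lemma nth_positions w a : a < size w -> nth 0 (positions w) a = index a.+1 w.
Proof. by move=> h; rewrite (nth_map 0) ?size_iota // nth_iota. Qed.

Lemma positions_inj n w w' : perm_word n w -> perm_word n w' ->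
  positions w = positions w' -> w = w'.
Proof.
move=> pw pw' e; have sw := perm_word_size pw; have sw' := perm_word_size pw'.
apply: (@eq_from_nth _ 0) => [|p hp]; first by rewrite sw sw'.
have := mem_nth 0 hp; rewrite (perm_word_mem _ pw); set a := nth 0 w p => ha.
have ia : index a w = p by rewrite index_uniq // (perm_word_uniq pw).
have : index a w' = index a w.
  move: (congr1 (nth 0 ^~ a.-1) e); rewrite /= !nth_positions; try lia.
  by rewrite prednK //; lia.
by rewrite ia => <-; rewrite nth_index // (perm_word_mem _ pw').
Qed.

Lemma perm_positions n w : perm_word n w -> perm_eq (positions w) (iota 0 n).
Proof.
move=> pw; have sw := perm_word_size pw.
have up : uniq (positions w).
  rewrite map_inj_in_uniq ?iota_uniq // => a b; rewrite !mem_iota => ha hb e.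
  by rewrite -(nth_index 0 (x := a) (s := w)) ?e ?nth_index // (perm_word_mem _ pw);
    lia.
have sub : {subset positions w <= iota 0 n}.
  move=> p /mapP[a]; rewrite mem_iota => ha ->.
  by rewrite mem_iota add0n /= -sw index_mem (perm_word_mem _ pw); lia.
have := uniq_min_size up sub; rewrite size_positions sw size_iota leqnn => -[//|_ e].
by apply: uniq_perm => //; apply: iota_uniq.
Qed.

(** Both lists are sorted by position in [w] and have the same members. *)
Lemma subword3E n w x y z i : perm_word n w ->
  perm_eq [:: x; y; z] [:: i.-1; i; i.+1] -> 1 < i < n ->
  index x w < index y w < index z w -> subword3 i w = [:: x; y; z].
Proof.
move=> pw pe hi hxyz.
pose lt a b := index a w < index b w.
have ltt : transitive lt by move=> b a c; apply: ltn_trans.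
have lti : irreflexive lt by move=> a; apply: ltnn.
apply: (irr_sorted_eq ltt lti).
- apply: sorted_filter => //.
  apply/(sortedP 0) => p hp; have uw := perm_word_uniq pw.
  by rewrite /lt index_uniq ?index_uniq ?(ltnW hp).
- by rewrite /= /lt; case/andP: hxyz => -> ->.
- move=> u; rewrite mem_filter (perm_mem pe) (perm_word_mem _ pw).
  by rewrite !inE; apply: andb_idr => /or3P[]/eqP->; lia.
Qed.

Definition relabel (i x y z a : nat) : nat :=
  if a == i.-1 then x else if a == i then y else if a == i.+1 then z else a.

(** Refilling the three places in a new order is a relabelling of the letters, and the clause that
    applies depends only on the order of [a], [b], [c]. *)
Lemma edualE n w i : perm_word n w -> 1 < i < n ->
  let a := index i.-1 w in let b := index i w in let c := index i.+1 w in
  edual i w =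
    (if (b < a < c) || (c < a < b) then map (relabel i i.-1 i.+1 i) w
     else if (b < c < a) || (a < c < b) then map (relabel i i i.-1 i.+1) w
     else w) /\
  edual_tilde i w =
    (if (b < a < c) || (c < a < b) then map (relabel i i.+1 i.-1 i) w
     else if (b < c < a) || (a < c < b) then map (relabel i i i.+1 i.-1) w
     else w).
Proof.
move=> pw hi a b c.
have neq x y : 0 < x <= n -> x != y -> index x w != index y w.
  move=> hx; apply: contra_neq => e.
  have yw : y \in w by rewrite -index_mem -e index_mem (perm_word_mem _ pw).
  by rewrite -(nth_index 0 (x := x) (s := w)) ?e ?nth_index // (perm_word_mem _ pw).
have ab : a != b by apply: neq; lia.
have bc : b != c by apply: neq; lia.
have ac : a != c by apply: neq; lia.
have e1 : (i.-1 == i) = false by lia.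
have e2 : (i.-1 == i.+1) = false by lia.
have e3 : (i == i.+1) = false by lia.
have e4 : (i == i.-1) = false by lia.
have e5 : (i.+1 == i.-1) = false by lia.
have e6 : (i.+1 == i) = false by lia.
have pe x y z : (forall p : pred nat, p x + (p y + p z) = p i.-1 + (p i + p i.+1)) ->
    perm_eq [:: x; y; z] [:: i.-1; i; i.+1].
  by move=> h; apply/seq.permP => p; have := h p; rewrite /=; lia.
have sub x y z h := subword3E (x := x) (y := y) (z := z) pw h hi.
have E := (e1, e2, e3, e4, e5, e6, eqxx).
have relE u x y z u1 u2 u3 : perm_eq [:: u1; u2; u3] [:: i.-1; i; i.+1] ->
    [seq (if v \in [:: i.-1; i; i.+1] then nth v [:: x; y; z] (index v [:: u1; u2; u3])
          else v) | v <- u] =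
    map (relabel i (nth 0 [:: x; y; z] (index i.-1 [:: u1; u2; u3]))
      (nth 0 [:: x; y; z] (index i [:: u1; u2; u3]))
      (nth 0 [:: x; y; z] (index i.+1 [:: u1; u2; u3]))) u.
  move=> pu; apply: eq_map => v; rewrite /relabel !inE.
  have idx l : l \in [:: i.-1; i; i.+1] -> index l [:: u1; u2; u3] < 3.
    by move=> hl; rewrite (index_mem l [:: u1; u2; u3]) (perm_mem pu).
  do 3 (case: (v =P _) => [->|_] /=; first by apply: set_nth_default; apply: idx;
    rewrite !inE eqxx ?orbT).
  by [].
rewrite /edual /edual_tilde /replace3.
case: (ltngtP a b) ab => // ab _; case: (ltngtP b c) bc => // bc _;
  case: (ltngtP a c) ac => // ac _; try lia.
- have pe1 : perm_eq [:: i.-1; i; i.+1] [:: i.-1; i; i.+1] by apply: pe => p; lia.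
  by rewrite (sub _ _ _ pe1) ?ab ?bc ?ac // !(relE _ _ _ _ _ _ _ pe1) !eqseq_cons /= !E.
- have pe1 : perm_eq [:: i.-1; i.+1; i] [:: i.-1; i; i.+1] by apply: pe => p; lia.
  by rewrite (sub _ _ _ pe1) ?ab ?bc ?ac // !(relE _ _ _ _ _ _ _ pe1) !eqseq_cons /= !E.
- have pe1 : perm_eq [:: i.+1; i.-1; i] [:: i.-1; i; i.+1] by apply: pe => p; lia.
  by rewrite (sub _ _ _ pe1) ?ab ?bc ?ac // !(relE _ _ _ _ _ _ _ pe1) !eqseq_cons /= !E.
- have pe1 : perm_eq [:: i; i.-1; i.+1] [:: i.-1; i; i.+1] by apply: pe => p; lia.
  by rewrite (sub _ _ _ pe1) ?ab ?bc ?ac // !(relE _ _ _ _ _ _ _ pe1) !eqseq_cons /= !E.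
- have pe1 : perm_eq [:: i; i.+1; i.-1] [:: i.-1; i; i.+1] by apply: pe => p; lia.
  by rewrite (sub _ _ _ pe1) ?ab ?bc ?ac // !(relE _ _ _ _ _ _ _ pe1) !eqseq_cons /= !E.
- have pe1 : perm_eq [:: i.+1; i; i.-1] [:: i.-1; i; i.+1] by apply: pe => p; lia.
  by rewrite (sub _ _ _ pe1) ?ab ?bc ?ac // !(relE _ _ _ _ _ _ _ pe1) !eqseq_cons /= !E.
Qed.

Lemma perm_wordP n w : uniq w -> size w = n -> {in w, forall a, 0 < a <= n} ->
  perm_word n w.
Proof.
move=> uw sw h; have sub : {subset w <= iota 1 n}.
  by move=> a /h; rewrite mem_iota add1n ltnS.
have := uniq_min_size uw sub; rewrite sw size_iota leqnn => -[//|_ e].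
by apply: uniq_perm => //; apply: iota_uniq.
Qed.

Lemma positions_split j w : j.+2 < size w ->
  positions w = [seq index a w | a <- iota 1 j] ++
    [:: index j.+1 w, index j.+2 w, index j.+3 w &
        [seq index a w | a <- iota j.+4 (size w - j.+3)]].
Proof.
move=> h; rewrite /positions; have -> : size w = j + (3 + (size w - j.+3)) by lia.
rewrite iotaD map_cat iotaD; congr (_ ++ (_ :: _ :: _ :: _)).
by congr map; congr iota; lia.
Qed.

Section Relabel.
Variables (n j : nat) (w : seq nat) (x y z : nat).
Hypothesis pw : perm_word n w.
Hypothesis hj : j.+2 < n.
Hypothesis pxyz : perm_eq [:: x; y; z] [:: j.+1; j.+2; j.+3].
Let h := relabel j.+2 x y z.

Let mem3 : [&& x \in [:: j.+1; j.+2; j.+3], y \in [:: j.+1; j.+2; j.+3] &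
  z \in [:: j.+1; j.+2; j.+3]].
Proof. by rewrite -!(perm_mem pxyz) !inE !eqxx ?orbT. Qed.

Lemma relabel_inj : injective h.
Proof.
have : uniq [:: x; y; z] by rewrite (perm_uniq pxyz) /= !inE; lia.
move: mem3; rewrite /= !inE => m u a b; rewrite /h /relabel /=.
by repeat case: ifP => ?; lia.
Qed.

Lemma index_relabel a : index (h a) (map h w) = index a w.
Proof. exact: index_map relabel_inj _ _. Qed.

Lemma perm_word_relabel : perm_word n (map h w).
Proof.
apply: perm_wordP.
- by rewrite map_inj_uniq ?(perm_word_uniq pw) //; apply: relabel_inj.
- by rewrite size_map (perm_word_size pw).
move=> _ /mapP[a aw ->]; move: aw; rewrite (perm_word_mem _ pw).
by move: mem3; rewrite !inE /h /relabel /=; repeat case: ifP => ?; lia.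
Qed.

Lemma positions_relabel :
  positions (map h w) = take j (positions w) ++
    [:: index j.+1 (map h w), index j.+2 (map h w), index j.+3 (map h w) &
        drop j.+3 (positions w)].
Proof.
have sw := perm_word_size pw.
have out a : (a <= j) || (j.+3 < a) -> index a (map h w) = index a w.
  move=> ha; rewrite -[RHS]index_relabel; congr index.
  by rewrite /h /relabel /=; repeat case: ifP => ?; lia.
rewrite [LHS](positions_split (j := j)) size_map sw //.
rewrite [positions w](positions_split (j := j)) sw //.
rewrite take_size_cat ?size_map ?size_iota //.
have e s t a b c : size s = j -> drop j.+3 (s ++ [:: a, b, c & t]) = t.
  by move=> <-; rewrite -[(size s).+3]/(3 + size s) -drop_drop drop_size_cat //= drop0.
rewrite e ?size_map ?size_iota //; congr (_ ++ [:: _, _, _ & _]).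
  by apply/eq_in_map => a; rewrite mem_iota => ha; apply: out; lia.
by apply/eq_in_map => a; rewrite mem_iota => ha; apply: out; lia.
Qed.

End Relabel.

(* [D_i], with P saying which sets of positions are pistoled. *)
Definition edual_at (P : pred (seq nat)) (i : nat) (w : seq nat) : seq nat :=
  if P [:: index i.-1 w; index i w; index i.+1 w]
  then edual_tilde i w else edual i w.

(** Relabelling keeps each place, so the new position of a label is the old position of the label
    sent to it; this turns the relabellings of [edualE] into the triples of [kmove]. *)
Lemma edual_atP P n w i : perm_word n w -> 1 < i < n ->
  perm_word n (edual_at P i w) /\
  positions (edual_at P i w) = dmove P i (positions w).
Proof.
case: i => [|[|j]] // pw hj.
have [e1 e2] := edualE pw hj.
have sw := perm_word_size pw; have hj' : j.+2 < n by case/andP: hj.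
rewrite /= in e1 e2.
rewrite /edual_at [j.+2.-1]/= e1 e2 {e1 e2}.
set a := index j.+1 w; set b := index j.+2 w; set c := index j.+3 w.
have epos : positions w = take j (positions w) ++ [:: a, b, c & drop j.+3 (positions
  w)].
  rewrite -{1}[positions w](cat_take_drop j); congr cat.
  have lt k : k < 3 -> j + k < size (positions w) by rewrite size_positions sw; lia.
  have := lt 0 isT; have := lt 1 isT; have := lt 2 isT;
    rewrite addn0 addn1 addn2 => l2 l1 l0.
  rewrite (drop_nth 0 l0) (drop_nth 0 l1) (drop_nth 0 l2).
  by rewrite size_positions in l0 l1 l2; rewrite !nth_positions.
have -> : dmove P j.+2 (positions w) =
    take j (positions w) ++ kmove (P [:: a; b; c]) a b c ++ drop j.+3 (positions w).
  have szp : size (take j (positions w)) = j.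
    by rewrite size_takel // size_positions sw; lia.
  by rewrite {1}epos -{1}szp dmove_cat.
have perm3 x y z : (forall p : pred nat, p x + (p y + p z) = p j.+1 + (p j.+2 + p
  j.+3)) ->
    perm_eq [:: x; y; z] [:: j.+1; j.+2; j.+3].
  by move=> h; apply/seq.permP => p; have := h p; rewrite /=; lia.
have idx x y z u : perm_eq [:: x; y; z] [:: j.+1; j.+2; j.+3] ->
    index (relabel j.+2 x y z u) (map (relabel j.+2 x y z) w) = index u w.
  by move=> pe; exact: (index_relabel pw hj' pe u).
have main x y z : perm_eq [:: x; y; z] [:: j.+1; j.+2; j.+3] ->
    perm_word n (map (relabel j.+2 x y z) w) /\
    positions (map (relabel j.+2 x y z) w) = take j (positions w) ++
    [:: index j.+1 (map (relabel j.+2 x y z) w), index j.+2 (map (relabel j.+2 x y z)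
      w),
        index j.+3 (map (relabel j.+2 x y z) w) & drop j.+3 (positions w)].
  by move=> pe; split;
    [apply: perm_word_relabel pw hj' pe|apply: positions_relabel pw hj' pe].
have E : (j.+2 == j.+1 = false) * (j.+3 == j.+1 = false) * (j.+3 == j.+2 = false).
  by split; [split|]; lia.
have r1 x y z : relabel j.+2 x y z j.+1 = x by rewrite /relabel eqxx.
have r2 x y z : relabel j.+2 x y z j.+2 = y by rewrite /relabel !E eqxx.
have r3 x y z : relabel j.+2 x y z j.+3 = z by rewrite /relabel !E eqxx.
rewrite /kmove.
case h1: ((b < a < c) || (c < a < b)); [|case h2: ((b < c < a) || (a < c < b))];
  last by rewrite if_same; split; rewrite //= -epos.
  case: (P _).
    have pe : perm_eq [:: j.+3; j.+1; j.+2] [:: j.+1; j.+2; j.+3] by apply: perm3 => p;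
      lia.
    have [-> ->] := main _ _ _ pe; split=> //.
    have := idx _ _ _ j.+1 pe; have := idx _ _ _ j.+2 pe; have := idx _ _ _ j.+3 pe.
    by rewrite r1 r2 r3 => -> -> ->.
  have pe : perm_eq [:: j.+1; j.+3; j.+2] [:: j.+1; j.+2; j.+3] by apply: perm3 => p;
    lia.
  have [-> ->] := main _ _ _ pe; split=> //.
  have := idx _ _ _ j.+1 pe; have := idx _ _ _ j.+2 pe; have := idx _ _ _ j.+3 pe.
  by rewrite r1 r2 r3 => -> -> ->.
case: (P _).
  have pe : perm_eq [:: j.+2; j.+3; j.+1] [:: j.+1; j.+2; j.+3] by apply: perm3 => p;
    lia.
  have [-> ->] := main _ _ _ pe; split=> //.
  have := idx _ _ _ j.+1 pe; have := idx _ _ _ j.+2 pe; have := idx _ _ _ j.+3 pe.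
  by rewrite r1 r2 r3 => -> -> ->.
have pe : perm_eq [:: j.+2; j.+1; j.+3] [:: j.+1; j.+2; j.+3] by apply: perm3 => p; lia.
have [-> ->] := main _ _ _ pe; split=> //.
have := idx _ _ _ j.+1 pe; have := idx _ _ _ j.+2 pe; have := idx _ _ _ j.+3 pe.
by rewrite r1 r2 r3 => -> -> ->.
Qed.

Lemma word_model P (G : scgraph) (rd : G -> seq nat) : subset_closed P ->
  injective rd ->
  (forall v, perm_word (degree G) (rd v)) ->
  (forall v i, i.+1 < degree G -> nth false (signature v) i =
     (index i.+1 (rd v) < index i.+2 (rd v))) ->
  (forall i u v, edge i u v = [&& 2 <= i < degree G, u != v &
     (edual_at P i (rd u) == rd v) || (edual_at P i (rd v) == rd u)]) ->
  (forall v i, 2 <= i < degree G -> exists u, rd u = edual_at P i (rd v)) ->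
  model P (fun v : G => positions (rd v)).
Proof.
move=> subP injr pw sig edg clo; split.
- by move=> u v /(positions_inj (pw u) (pw v)) /injr.
- by move=> v; rewrite (perm_uniq (perm_positions (pw v))) iota_uniq.
- by move=> v; rewrite size_positions (perm_word_size (pw v)).
- move=> v i hi; rewrite sig // !nth_positions ?(perm_word_size (pw v)) //; lia.
- move=> i u v; rewrite edg; case hi: (2 <= i < degree G) => //=; congr andb.
  have key a b : (edual_at P i (rd a) == rd b) =
      (positions (rd b) == dmove P i (positions (rd a))).
    have [p1 p2] := edual_atP P (pw a) hi.
    rewrite -p2; apply/eqP/eqP => [->//|e].
    by apply: (positions_inj p1 (pw b)); rewrite e.
  (* The move is an involution, so the two alternatives in the definition of an edge are the same
     condition. *)
  rewrite !key; apply: orb_idr => /eqP e.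
  by rewrite e dmoveK //; case/andP: hi.
- move=> v i hi; have [u hu] := clo v i hi.
  by exists u; rewrite hu; have [] := edual_atP P (pw v) hi.
Qed.

(** * Reading order, pistols and components of the Assaf graph *)

Section Cells.
Variable delta : diagram.

Lemma row_order_total : total (fun c c' : delta => row_order (val c) (val c')).
Proof. by move=> [[x y] ?] [[x' y'] ?]; rewrite /row_order /=; lia. Qed.

Lemma row_order_trans : transitive (fun c c' : delta => row_order (val c) (val c')).
Proof. by move=> [[x y] ?] [[x' y'] ?] [[x'' y''] ?]; rewrite /row_order /=; lia. Qed.

Lemma row_order_anti : antisymmetric (fun c c' : delta => row_order (val c) (val c')).
Proof.
move=> [[x y] h] [[x' y'] h'] e; apply: val_inj => /=; move: e; rewrite /row_order /=.
by move=> e; congr pair; lia.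
Qed.

Lemma mem_cells c : c \in cells delta.
Proof. by rewrite mem_sort mem_enum. Qed.

Lemma uniq_cells : uniq (cells delta).
Proof. by rewrite sort_uniq enum_uniq. Qed.

Lemma size_cells : size (cells delta) = #|` delta|%fset.
Proof. by rewrite size_sort -cardE cardfE. Qed.

Lemma index_cells c c' :
  (index c (cells delta) <= index c' (cells delta)) = row_order (val c) (val c').
Proof.
have srt := sort_sorted row_order_total (enum {: delta}).
have refl : reflexive (fun c c' : delta => row_order (val c) (val c')).
  by move=> d; have := row_order_total d d; rewrite orbb.
apply/idP/idP => [|h].
  by apply: (sorted_leq_index row_order_trans refl srt); apply: mem_cells.
apply: contraT; rewrite -ltnNge => lt; have h' := ltnW lt.
have h2 := sorted_leq_index row_order_trans refl srt _ _ (mem_cells c') (mem_cells c)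
  h'.
by rewrite (row_order_anti (introT andP (conj h h2))) ltnn in lt.
Qed.

Lemma index_cells_lt c c' :
  (index c (cells delta) < index c' (cells delta)) = ~~ row_order (val c') (val c).
Proof. by rewrite ltnNge index_cells. Qed.

Lemma pistoled_subset : subset_closed (pistoled delta).
Proof.
move=> s s' sub /existsP[c /allP h]; apply/existsP; exists c.
by apply/allP => p /sub /h.
Qed.

(** A pistol is an interval of the reading order: the end of one row followed by the beginning of
    the row below. *)
Lemma pistoled_convex : convex (pistoled delta).
Proof.
move=> a b d /andP[ab bd] /existsP[c /= /and3P[/hasP[ca _ /andP[pa /eqP ia]]
  /hasP[cd _ /andP[pd /eqP id]] _]].
have hb : b < size (cells delta).
  by apply: ltn_trans bd _; rewrite -id index_mem mem_cells.
pose cb := nth ca (cells delta) b.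
have ib : index cb (cells delta) = b by rewrite index_uniq // uniq_cells.
have pb : pistol c cb.
  have hab : row_order (val ca) (val cb) by rewrite -index_cells ia ib ltnW.
  have hbd : row_order (val cb) (val cd) by rewrite -index_cells ib id ltnW.
  move: pa pd hab hbd; rewrite /row_order /pistol.
  case: (val c) => x y; case: (val ca) => xa ya; case: (val cb) => xb yb.
  case: (val cd) => xd yd /=.
  lia.
apply/existsP; exists c => /=; apply/and4P; split=> //.
- by apply/hasP; exists ca; rewrite ?mem_cells ?pa ?ia /=.
- by apply/hasP; exists cb; rewrite ?mem_cells ?pb ?ib /=.
- by apply/hasP; exists cd; rewrite ?mem_cells ?pd ?id /=.
Qed.

End Cells.

Lemma one_line_perm_word n (s : 'S_n) : perm_word n (one_line s).
Proof.
apply: perm_wordP.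
- by rewrite map_inj_uniq ?enum_uniq // => i j [] /val_inj /perm_inj.
- by rewrite size_map size_enum_ord.
- by move=> _ /mapP[i _ ->] /=.
Qed.

Lemma one_line_inj n : injective (@one_line n).
Proof.
move=> s t /eq_in_map e; apply/permP => i.
by apply: val_inj; have [] := e i (mem_enum _ _).
Qed.

Lemma one_line_surj n w : perm_word n w -> exists s : 'S_n, one_line s = w.
Proof.
move=> pw; have sw := perm_word_size pw.
have hp (i : 'I_n) : (nth 0 w i).-1 < n.
  have : nth 0 w i \in w by rewrite mem_nth // sw.
  by rewrite (perm_word_mem _ pw); lia.
pose f i := Ordinal (hp i).
have fE (i : 'I_n) : (f i).+1 = nth 0 w i.
  have : nth 0 w i \in w by rewrite mem_nth // sw.
  by rewrite (perm_word_mem _ pw) /=; lia.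
have injf : injective f.
  move=> i j /(congr1 (fun k : 'I_n => (k : nat).+1)); rewrite !fE.
  by move/eqP; rewrite nth_uniq ?sw ?(perm_word_uniq pw) // => /eqP/val_inj.
exists (perm injf); apply: (@eq_from_nth _ 0); rewrite size_map size_enum_ord //.
move=> p hp'; rewrite (nth_map (Ordinal hp')) ?size_enum_ord // permE fE.
by rewrite nth_enum_ord.
Qed.

Section Component.
Variables (delta : diagram) (V : {set 'S_(#|` delta|%fset)}).
Hypothesis hV : is_component (G := assaf_graph delta) V.
Let G := induced (G := assaf_graph delta) V.

Lemma component_model :
  model (pistoled delta) (fun v : G => positions (one_line (val v))).
Proof.
apply: word_model.
- exact: pistoled_subset.
- by move=> u v /one_line_inj /val_inj.
- by move=> v; apply: one_line_perm_word.
- move=> v i hi; have hi2 : i.+1 < #|` delta|%fset := hi.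
  have hi' : i < (#|` delta|%fset).-1 by lia.
  by rewrite (nth_map (Ordinal hi')) ?size_enum_ord // nth_enum_ord.
- by move=> i u v; rewrite /= /iedge /= /wedge.
move=> [v vV] i hi; have [p1 _] := edual_atP (pistoled delta) (one_line_perm_word v) hi.
have [s hs] := one_line_surj p1.
(* [v] and its image are equal or adjacent, so the image stays in the component. *)
have [eq|ne] := eqVneq v s.
  by exists (exist _ v vV); rewrite /= -hs eq.
have sV : s \in V.
  have /andP[hi1 hi2] : 2 <= i < #|` delta|%fset := hi.
  have vs : adjacent (G := assaf_graph delta) v s.
    apply/existsP; exists (Ordinal hi2); apply/and3P; split=> //.
    by apply/orP; left; apply/eqP; rewrite hs.
  case: hV => v0 eV; move: vV; rewrite eV !inE => /connect_trans; apply.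
  exact: connect1 vs.
by exists (exist _ s sV).
Qed.

End Component.

(** * Standard Young tableaux *)

Lemma mem_young la c : reflect
  (exists x y : nat, c = (Posz x, Posz y) /\ x < nth 0 la y) (c \in young_diagram la).
Proof.
rewrite inE; apply: (iffP allpairsPdep) => [[y [x [_ hx ->]]]|[x [y [-> h]]]].
  by exists x, y; split=> //; move: hx; rewrite mem_iota.
exists y, x; rewrite !mem_iota /=; split=> //.
by rewrite ltnNge; apply: contraL h => /(nth_default 0) ->.
Qed.

Lemma size_young la : #|` young_diagram la|%fset = sumn la.
Proof.
rewrite card_fseq undup_id.
  rewrite size_allpairs_dep; congr sumn.
  under eq_map do rewrite size_iota.
  by rewrite map_nth_iota0 ?take_size.
apply: allpairs_uniq_dep; first exact: iota_uniq.
  by move=> y _; apply: iota_uniq.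
by move=> [y x] [y' x'] _ _ /= [-> ->].
Qed.

Lemma part_nth_leq la i j : is_part la -> i <= j -> nth 0 la j <= nth 0 la i.
Proof.
case/andP => srt _ ij; have [hj|hj] := ltnP j (size la); last by rewrite nth_default.
by apply: (sorted_leq_nth (rev_trans leq_trans) leqnn 0 srt) => //; rewrite inE; lia.
Qed.

Section Tableaux.
Variable la : seq nat.
Hypothesis partla : is_part la.
Local Notation n := (sumn la).
Local Notation Y := (young_diagram la).

Lemma young_ge0 (c : Y) : ((0 <= (val c).1) && (0 <= (val c).2))%R.
Proof. by have /mem_young [x [y [-> _]]] := valP c. Qed.

Lemma young_down (c : Y) (x y : int) :
  (0 <= x <= (val c).1)%R -> (0 <= y <= (val c).2)%R ->
  exists d : Y, (val d) = (x, y).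
Proof.
have /mem_young [a [b [-> h]]] := valP c => /= hx hy.
suff H : (x, y) \in Y by exists [` H]%fset.
apply/mem_young; exists `|x|%N, `|y|%N; split; first by congr pair; lia.
apply: leq_ltn_trans (_ : a < _); first by lia.
by apply: leq_trans h (part_nth_leq partla _); lia.
Qed.

Section OneTableau.
Variable T : SYT la.

Lemma SYT_perm_word : perm_word n (reading_word (val T)).
Proof. by case/and3P: (valP T). Qed.

Lemma SYT_row (c c' : Y) : (val c).2 = (val c').2 -> ((val c).1 < (val c').1)%R ->
  val T c < val T c'.
Proof.
case/and3P: (valP T) => _ /forallP /(_ c) /forallP /(_ c') /implyP h _ e l.
by apply: h; rewrite e eqxx.
Qed.

Lemma SYT_col (c c' : Y) : (val c).1 = (val c').1 -> ((val c).2 < (val c').2)%R ->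
  val T c < val T c'.
Proof.
case/and3P: (valP T) => _ _ /forallP /(_ c) /forallP /(_ c') /implyP h e l.
by apply: h; rewrite e eqxx.
Qed.

Lemma SYT_inj (c c' : Y) : val T c = val T c' :> nat -> c = c'.
Proof.
move=> e; have := perm_word_uniq SYT_perm_word.
move/(@uniqP _ 0) => /(_ (index c (cells Y)) (index c' (cells Y))).
rewrite !inE size_map !index_mem !mem_cells !(nth_map c) ?index_mem ?mem_cells //.
by rewrite !nth_index ?mem_cells // => /(_ isT isT e) /(congr1 (nth c (cells Y)));
  rewrite !nth_index ?mem_cells.
Qed.

Lemma SYT_bound (c : Y) : 0 < val T c <= n.
Proof.
rewrite -(perm_word_mem _ SYT_perm_word); apply/mapP; exists c => //.
exact: mem_cells.
Qed.

Lemma SYT_index (c : Y) : index (val T c : nat) (reading_word (val T)) = index c (cells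
  Y).
Proof. by rewrite /reading_word (index_map (f := fun c => val T c : nat)) // => d d'
  /SYT_inj. Qed.

Lemma SYT_surj a : 0 < a <= n -> exists c : Y, val T c = a :> nat.
Proof.
by rewrite -(perm_word_mem _ SYT_perm_word) => /mapP[c _ ->]; exists c.
Qed.

End OneTableau.

Lemma reading_word_inj (T T' : SYT la) :
  reading_word (val T) = reading_word (val T') -> T = T'.
Proof.
move=> e; apply: val_inj; apply/ffunP => c; apply: val_inj => /=.
by have /eq_in_map /(_ c (mem_cells c)) := e.
Qed.

Definition swap (j a : nat) : nat :=
  if a == j then j.+1 else if a == j.+1 then j else a.

Lemma swap_inj j : injective (swap j).
Proof. by move=> a b; rewrite /swap; repeat case: ifP => ?; lia. Qed.

Definition row_between (a b c : cell) : bool :=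
  (~~ row_order c a && ~~ row_order b c) || (~~ row_order c b && ~~ row_order a c).

Lemma same_row_between (a b c : cell) : a.2 = b.2 -> (a.1 < b.1)%R ->
  row_between a b c -> [/\ a.2 = c.2, (a.1 < c.1)%R & (c.1 < b.1)%R].
Proof.
move: a b c => [xa ya] [xb yb] [xc yc]; rewrite /row_between /row_order /=.
by move=> h1 h2 h3; split; lia.
Qed.

Lemma same_col_between (a b c : cell) : a.1 = b.1 -> (a.2 < b.2)%R ->
  row_between a b c -> [\/ c.2 = b.2 /\ (b.1 < c.1)%R,
    c.2 = a.2 /\ (c.1 < a.1)%R | (a.2 < c.2)%R /\ (c.2 < b.2)%R].
Proof.
move: a b c => [xa ya] [xb yb] [xc yc]; rewrite /row_between /row_order /=.
move=> h1 h2 h3; have : [|| (yc == yb) && (xb < xc)%R, (yc == ya) && (xc < xa)%R |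
  (ya < yc)%R && (yc < yb)%R] by lia.
by case/or3P => /andP[h4 h5]; [apply: Or31|apply: Or32|apply: Or33]; split=> //; lia.
Qed.

(* A witness label j-1 or j+2 read between j and j+1 prevents them from being in
   the same row or in the same column. *)
Lemma SYT_swap (T : SYT la) j z (p := fun a => index a (reading_word (val T))) :
  0 < j < n -> 0 < z <= n -> (z.+1 == j) || (z == j.+2) ->
  (p j < p z < p j.+1) || (p j.+1 < p z < p j) ->
  exists T' : SYT la, reading_word (val T') = map (swap j) (reading_word (val T)).
Proof.
move=> hj hz wz; rewrite /p.
have [|c1 e1] := @SYT_surj T j; first by lia.
have [|c2 e2] := @SYT_surj T j.+1; first by lia.
have [c3 e3] := @SYT_surj T z hz.
have idx a c : val T c = a :> nat -> index a (reading_word (val T)) = index c (cells Y).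
  by move=> <-; apply: SYT_index.
rewrite (idx _ _ e1) (idx _ _ e2) (idx _ _ e3) !index_cells_lt -/(row_between (val c1)
  (val c2) (val c3)) => btw.
(* In a common row the witness would lie between the two cells, and its entry strictly between [j]
   and [j.+1]. *)
have row12 : (val c1).2 <> (val c2).2.
  move=> er; have x12 : ((val c1).1 < (val c2).1)%R.
    have [lt|lt|eq] := Order.TotalTheory.ltgtP (val c1).1 (val c2).1 => //.
      by have := SYT_row T (esym er) lt; lia.
    have c12 : c1 = c2 by apply: val_inj;
      rewrite [val c1]surjective_pairing eq er -surjective_pairing.
    by move: e1 e2; rewrite c12; lia.
  have [er3 lt1 lt2] := same_row_between er x12 btw.
  have := SYT_row T er3 lt1; have := SYT_row T (etrans (esym er3) er) lt2; lia.
have col12 : (val c1).1 <> (val c2).1.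
  move=> ec; have y12 : ((val c1).2 < (val c2).2)%R.
    have [lt|lt|//] := Order.TotalTheory.ltgtP (val c1).2 (val c2).2 => //.
    by have := SYT_col T (esym ec) lt; lia.
  have g1 := young_ge0 c1; have g2 := young_ge0 c2; have g3 := young_ge0 c3.
  (* The corner [d] has entry [j.+1] in the first case and [j] in the second, which [c2] and [c1]
     already hold elsewhere; in the third its entry would lie strictly between [j] and [j.+1]. *)
  case: (same_col_between ec y12 btw) => [[er lt]|[er lt]|[lt1 lt2]].
  - have [d ed] : exists d : Y, val d = ((val c3).1, (val c1).2).
      by apply: (young_down (c := c3)); lia.
    have h1 : val T c1 < val T d by apply: SYT_row; rewrite ed //= ec.
    have h2 : val T d < val T c3 by apply: SYT_col; rewrite ed //= er.
    have h3 : val T c2 < val T c3 by apply: SYT_row.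
    have dc : d = c2 by apply: (@SYT_inj T); lia.
    by move: ed lt; rewrite dc => ->; rewrite /= Order.POrderTheory.ltxx.
  - have [d ed] : exists d : Y, val d = ((val c3).1, (val c2).2).
      by apply: (young_down (c := c2)); lia.
    have h1 : val T c3 < val T d by apply: SYT_col; rewrite ed //= er.
    have h2 : val T d < val T c2 by apply: SYT_row; rewrite ed //= -ec.
    have h3 : val T c3 < val T c1 by apply: SYT_row.
    have dc : d = c1 by apply: (@SYT_inj T); lia.
    by move: ed lt; rewrite dc => ->; rewrite /= Order.POrderTheory.ltxx.
  - have [d ed] : exists d : Y, val d = ((val c1).1, (val c3).2).
      by apply: (young_down (c := c2)); lia.
    have h1 : val T c1 < val T d by apply: SYT_col; rewrite ed.
    have h2 : val T d < val T c2 by apply: SYT_col; rewrite ed.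
    lia.
(* Exchanging two consecutive values reverses only the pair [c1], [c2], which shares no row or
   column. *)
have lt_swap (c c' : Y) : (val c).2 = (val c').2 \/ (val c).1 = (val c').1 ->
    val T c < val T c' -> swap j (val T c) < swap j (val T c').
  move=> h lt; have ne : ~~ ((val T c == j :> nat) && (val T c' == j.+1 :> nat)).
    apply/negP => /andP[/eqP ec /eqP ec'].
    have c'2 : c' = c2 by apply: (@SYT_inj T); rewrite ec' e2.
    have c1' : c = c1 by apply: (@SYT_inj T); rewrite ec e1.
    by case: h; rewrite c'2 c1'.
  by rewrite /swap; repeat case: ifP => ?; lia.
pose T' : filling la := [ffun c => inord (swap j (val T c))].
have vT' c : T' c = swap j (val T c) :> nat.
  rewrite ffunE inordK //; have := SYT_bound T c.
  by rewrite /swap; repeat case: ifP => ?; lia.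
have rw : reading_word T' = map (swap j) (reading_word (val T)).
  by rewrite /reading_word -map_comp; apply: eq_map => c /=.
suff sT : is_SYT T' by exists (exist _ T' sT).
apply/and3P; split.
- rewrite rw; apply: perm_wordP.
  + by rewrite map_inj_uniq ?(perm_word_uniq (SYT_perm_word T)) //; apply: swap_inj.
  + by rewrite size_map (perm_word_size (SYT_perm_word T)).
  move=> u /mapP[a]; rewrite (perm_word_mem _ (SYT_perm_word T)) => ha ->.
  by rewrite /swap; repeat case: ifP => ?; lia.
- apply/forallP => c; apply/forallP => c'; apply/implyP => /andP[/eqP er lt].
  by rewrite !vT'; apply: lt_swap; [left|apply: SYT_row].
- apply/forallP => c; apply/forallP => c'; apply/implyP => /andP[/eqP er lt].
  by rewrite !vT'; apply: lt_swap; [right|apply: SYT_col].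
Qed.

(** When non-trivial, d_i exchanges two consecutive labels, and the third label, read between them,
    is the witness that [SYT_swap] asks for. *)
Lemma SYT_edual (T : SYT la) i : 1 < i < n ->
  exists T' : SYT la, reading_word (val T') = edual i (reading_word (val T)).
Proof.
move=> hi; have [-> _] := edualE (SYT_perm_word T) hi.
have sw x y z j w : (forall a, relabel i x y z a = swap j a) ->
  map (relabel i x y z) w = map (swap j) w by move=> h; apply: eq_map.
case: ifP => h1; [|case: ifP => h2]; last by exists T.
  rewrite (sw _ _ _ i); first by apply: (SYT_swap (z := i.-1)); lia.
  by move=> a; rewrite /relabel /swap; repeat case: ifP => ?; lia.
rewrite (sw _ _ _ i.-1).
  by apply: (SYT_swap (z := i.+1)); rewrite ?prednK; lia.
by move=> a; rewrite /relabel /swap; repeat case: ifP => ?; lia.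
Qed.

Lemma standard_model :
  model xpred0 (fun T : standard_graph la => positions (reading_word (val T))).
Proof.
apply: (word_model (P := xpred0)) => //.
- by move=> T T' /reading_word_inj.
- exact: SYT_perm_word.
- move=> T i hi; have hi2 : i.+1 < n := hi.
  have hi' : i < n.-1 by lia.
  by rewrite (nth_map (Ordinal hi')) ?size_enum_ord // nth_enum_ord.
- exact: SYT_edual.
Qed.

End Tableaux.

(** * Standardization and Yamanouchi words *)

Definition occ (w : seq nat) (a : nat) : seq nat :=
  [seq p <- iota 0 (size w) | nth 0 w p == a].

Lemma occ_sorted w a : sorted ltn (occ w a).
Proof. by apply: sorted_filter; [apply: ltn_trans|apply: iota_ltn_sorted]. Qed.

Lemma mem_occ w a p : (p \in occ w a) = (p < size w) && (nth 0 w p == a).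
Proof. by rewrite mem_filter mem_iota andbC. Qed.

Lemma count_iota_nth (w : seq nat) (a p : nat) : p <= size w ->
  count (fun q => nth 0 w q == a) (iota 0 p) = count_mem a (take p w).
Proof. by move=> hp; rewrite -(map_nth_iota0 0 hp) count_map. Qed.

Lemma size_occ (w : seq nat) (a : nat) : size (occ w a) = count_mem a w.
Proof. by rewrite size_filter count_iota_nth // take_size. Qed.

Lemma count_occ (w : seq nat) (a k : nat) : count_mem a (drop k w) = count (leq k) (occ
  w a).
Proof.
rewrite count_filter.
have [hk|hk] := leqP (size w) k.
  rewrite drop_oversize //=; apply/esym/eqP; rewrite -leqn0 leqNgt -has_count.
  by apply/hasPn => p; rewrite mem_iota => hp; apply/negP => /andP[kp _];
    move: hp kp => /=; lia.
have -> : size w = k + (size w - k) by lia.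
rewrite iotaD count_cat add0n.
have -> : count [predI leq k & fun p => nth 0 w p == a] (iota 0 k) = 0.
  apply/eqP; rewrite -leqn0 leqNgt -has_count.
  by apply/hasPn => p; rewrite mem_iota => hp; apply/negP => /andP[kp _];
    move: hp kp => /=; lia.
have -> : drop k w = map (nth 0 w) (iota k (size w - k)).
  apply: (@eq_from_nth _ 0); rewrite size_drop ?size_map ?size_iota // => i hi.
  by rewrite nth_drop (nth_map 0) ?size_iota // nth_iota.
rewrite count_map; apply: eq_in_count => p; rewrite mem_iota /=.
by case/andP => ->.
Qed.

Lemma nth_occ (w : seq nat) (p : nat) : p < size w ->
  nth 0 (occ w (nth 0 w p)) (count_mem (nth 0 w p) (take p w)) = p.
Proof.
move=> hp; rewrite /occ.
have -> : size w = p + (size w - p).-1.+1 by lia.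
rewrite iotaD filter_cat add0n /= eqxx nth_cat size_filter.
by rewrite count_iota_nth ?(ltnW hp) // ltnn subnn.
Qed.

Lemma sumn_count_mem (w : seq nat) (r : nat) : 0 \notin w ->
  sumn [seq count_mem a w | a <- iota 1 r] = count (fun b => b <= r) w.
Proof.
move=> w0; elim: r => [|r IH].
  by apply/esym/eqP; rewrite -leqn0 leqNgt -has_count;
    apply: contra w0 => /hasP[[|b] // hb _].
rewrite -[X in iota 1 X]addn1 iotaD map_cat sumn_cat IH /= addn0 add1n.
rewrite -(count_predUI (fun b => b <= r) (pred1 r.+1)).
rewrite (@eq_count _ (predI _ _) pred0) ?count_pred0 ?addn0.
  by apply: eq_count => b /=; lia.
by move=> b /=; lia.
Qed.

Section Standardize.
Variables (w : seq nat) (l : nat).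
Hypothesis w_gt0 : 0 \notin w.
Hypothesis w_le : {in w, forall a, a <= l}.
Let ss := [seq occ w a | a <- iota 1 l].
Let F := flatten ss.

Let shapeE : shape ss = [seq count_mem a w | a <- iota 1 l].
Proof. by rewrite /shape -map_comp; apply: eq_map => a /=; rewrite size_occ. Qed.

Let size_F : size F = size w.
Proof.
rewrite size_flatten shapeE sumn_count_mem //.
by apply/eqP; rewrite -all_count; apply/allP.
Qed.

(** [F] lists the places of the 1's, then those of the 2's, and so on. The letter given to [p]
    counts the entries of [F] up to and including [p], so it is one more than the index of [p] in
    [F]. *)
Lemma nth_standardize p : p < size w ->
  [/\ 0 < nth 0 (standardize w) p <= size w
    & nth 0 F (nth 0 (standardize w) p).-1 = p].
Proof.
move=> hp; rewrite (nth_map 0) ?size_iota // nth_iota // add0n.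
set a := nth 0 w p.
have aw : a \in w by apply: mem_nth.
have a0 : 0 < a by case: (a) aw w_gt0 => // ->.
have al := w_le aw.
rewrite (take_nth 0) // -/a -cats1 count_cat /= eqxx addn0 addn1 addnS.
set c := count_mem a (take p w).
have sha : nth 0 (shape ss) a.-1 = count_mem a w.
  by rewrite shapeE (nth_map 0) ?size_iota ?nth_iota ?add1n ?prednK //; lia.
have hc : c < nth 0 (shape ss) a.-1.
  by rewrite sha -[in X in _ < X](cat_take_drop p w) count_cat (drop_nth 0) //= -/a -/c
    eqxx; lia.
have fi : flatten_index (shape ss) a.-1 c = count (fun b => b < a) w + c.
  rewrite /flatten_index; congr (_ + c).
  rewrite shapeE -map_take take_iota; have -> : minn a.-1 l = a.-1 by lia.
  by rewrite sumn_count_mem //; apply: eq_count => b; lia.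
have := flatten_indexP hc; rewrite fi -size_flatten -/F size_F => lt.
split; first by [].
rewrite /= -fi nth_flatten flatten_indexKl // flatten_indexKr //.
rewrite (nth_map 0) ?size_iota; last by lia.
by rewrite nth_iota ?add1n ?prednK ?nth_occ //; lia.
Qed.

Lemma standardize_perm_word : perm_word (size w) (standardize w).
Proof.
have sz : size (standardize w) = size w by rewrite size_map size_iota.
apply: perm_wordP => //.
  apply/(uniqP 0) => p q; rewrite !inE sz => hp hq e.
  by have [_ <-] := nth_standardize hp; have [_ <-] := nth_standardize hq; rewrite e.
by move=> a /(nthP 0)[p]; rewrite sz => hp <-; have [] := nth_standardize hp.
Qed.

Lemma positions_standardize : positions (standardize w) = F.
Proof.
have pw := standardize_perm_word; have sz := perm_word_size pw.
apply: (@eq_from_nth _ 0); rewrite size_positions sz ?size_F // => k hk.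
rewrite nth_positions ?sz //.
have : k.+1 \in standardize w by rewrite (perm_word_mem _ pw).
case/(nthP 0) => p; rewrite sz => hp e.
have [_] := nth_standardize hp; rewrite e /= => ->.
by rewrite -e index_uniq ?sz // (perm_word_uniq pw).
Qed.

End Standardize.

(** * Recovering a word from its standardization *)

Section Blocks.
Variables (n : nat) (mu u : seq nat).
Hypothesis sumn_mu : sumn mu = n.
Hypothesis pu : perm_word n u.
Let ss := reshape mu (positions u).
(** The labels 1, ..., n are cut into consecutive runs of lengths [mu], and a label in run i,
    counted from 0, becomes the letter i + 1. This inverts standardization when the labels of each
    run increase from left to right in [u]. *)
Definition block_word : seq nat := [seq (reshape_index mu a.-1).+1 | a <- u].

Let size_pu : size (positions u) = n.
Proof. by rewrite size_positions (perm_word_size pu). Qed.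
Let shape_ss : shape ss = mu.
Proof. by apply: reshapeKl; rewrite size_pu sumn_mu. Qed.
Let flat_ss : flatten ss = positions u.
Proof. by apply: reshapeKr; rewrite size_pu sumn_mu. Qed.

Lemma mem_block i p : i < size mu ->
  (p \in nth [::] ss i) = (p < n) && (nth 0 block_word p == i.+1).
Proof.
move=> hi; have su := perm_word_size pu.
apply/idP/andP => [|[hp]].
  case/(nthP 0) => c hc e.
  have szi : size (nth [::] ss i) = nth 0 mu i by rewrite -[in RHS]shape_ss nth_shape.
  have hc' : c < nth 0 (shape ss) i by rewrite nth_shape.
  have := flatten_indexP hc'; rewrite shape_ss sumn_mu => hf.
  have ep : nth 0 (positions u) (flatten_index mu i c) = p.
    rewrite -flat_ss nth_flatten shape_ss.
    by rewrite flatten_indexKl ?flatten_indexKr -?szi.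
  have fu : (flatten_index mu i c).+1 \in u by rewrite (perm_word_mem _ pu).
  rewrite nth_positions ?su // in ep.
  have hp : p < n by rewrite -ep -su index_mem.
  split=> //; rewrite (nth_map 0) ?su // -ep nth_index //=.
  by rewrite flatten_indexKl -?szi.
rewrite (nth_map 0) ?su // => /eqP [er].
have au : nth 0 u p \in u by rewrite mem_nth ?su.
have := au; rewrite (perm_word_mem _ pu) => ha.
have e : nth 0 (positions u) (nth 0 u p).-1 = p.
  rewrite nth_positions ?prednK ?su; try lia.
  by rewrite index_uniq ?su // (perm_word_uniq pu).
rewrite -e -flat_ss nth_flatten shape_ss er; apply: mem_nth.
rewrite -nth_shape shape_ss -er; apply: reshape_offsetP; rewrite sumn_mu; lia.
Qed.

Hypothesis sorted_blocks : forall i, sorted ltn (nth [::] ss i).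

Lemma occ_block_word i : occ block_word i.+1 = nth [::] ss i.
Proof.
have sw : size block_word = n by rewrite size_map (perm_word_size pu).
have [hi|hi] := ltnP i (size mu).
  apply: (irr_sorted_eq ltn_trans ltnn) => //; first exact: occ_sorted.
  by move=> p; rewrite mem_occ mem_block // sw.
rewrite [RHS]nth_default ?size_reshape //.
apply/eqP; rewrite -size_eq0 size_filter -leqn0 leqNgt -has_count.
apply/hasPn => p; rewrite mem_iota add0n sw => hp.
rewrite (nth_map 0) ?(perm_word_size pu) //.
have : nth 0 u p \in u by rewrite mem_nth ?(perm_word_size pu).
rewrite (perm_word_mem _ pu) => ha.
have := @reshape_indexP mu (nth 0 u p).-1; rewrite sumn_mu; lia.
Qed.

Lemma block_word_gt0 : 0 \notin block_word.
Proof. by apply/mapP => -[]. Qed.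

Lemma standardize_block_word : standardize block_word = u.
Proof.
have sw : size block_word = n by rewrite size_map (perm_word_size pu).
have le : {in block_word, forall a, a <= size mu}.
  move=> _ /mapP[a au ->]; apply: reshape_indexP; rewrite sumn_mu.
  by move: au; rewrite (perm_word_mem _ pu); lia.
have := standardize_perm_word block_word_gt0 le; rewrite sw => pw.
apply: (positions_inj pw pu);
  rewrite (positions_standardize block_word_gt0 le) -flat_ss.
congr flatten; apply: (@eq_from_nth _ [::]);
  rewrite size_map size_iota ?size_reshape //.
by move=> i hi; rewrite (nth_map 0) ?size_iota // nth_iota // occ_block_word.
Qed.

End Blocks.

(** * The Yamanouchi and non-jamming conditions on positions *)

Lemma count_geq_sorted (X : seq nat) (j k : nat) : sorted ltn X -> j < size X ->
  (j < count (leq k) X) = (k <= nth 0 X (size X - j.+1)).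
Proof.
move=> sX hj; set i := size X - j.+1.
have hi : i < size X by lia.
have mono a b : a <= b -> b < size X -> nth 0 X a <= nth 0 X b.
  move=> ab hb; have [->//|ne] := eqVneq a b.
  by apply/ltnW/(sorted_ltn_nth ltn_trans 0 sX); rewrite ?inE; lia.
have [h|h] := leqP k (nth 0 X i).
  rewrite -(cat_take_drop i X) count_cat.
  have : all (leq k) (drop i X).
    apply/(all_nthP 0) => a; rewrite size_drop nth_drop => ha.
    by apply: leq_trans h (mono _ _ _ _); lia.
  by rewrite all_count size_drop => /eqP ->; lia.
rewrite -(cat_take_drop i.+1 X) count_cat.
have : ~~ has (leq k) (take i.+1 X).
  apply/(has_nthP 0) => -[a]; rewrite size_takel // => ha.
  by rewrite nth_take // => h2; have := mono a i; lia.
rewrite has_count -leqNgt leqn0 => /eqP ->.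
by have := count_size (leq k) (drop i.+1 X); rewrite size_drop; lia.
Qed.

(** The first condition says that [q] comes from a standardization with runs of lengths [mu]. In the
    second, [drop] keeps as many of the last positions of a letter as the next letter has. *)
Definition yam_positions (P : pred (seq nat)) (mu q : seq nat) : Prop :=
  (forall i, sorted ltn (nth [::] (reshape mu q) i)) /\
  (forall i, i.+1 < size mu ->
     good P (drop (nth 0 mu i - nth 0 mu i.+1) (nth [::] (reshape mu q) i))
            (nth [::] (reshape mu q) i.+1)).

Section YamWord.
Variables (delta : diagram) (mu w : seq nat).
Hypothesis mu_part : is_part mu.
Hypothesis w_count : forall i, 0 < i -> count_mem i w = nth 0 mu i.-1.
Hypothesis w_size : size w = #|` delta|%fset.

Let size_occ' i : size (occ w i.+1) = nth 0 mu i.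
Proof. by rewrite size_occ w_count. Qed.

Let mu_leq i : nth 0 mu i.+1 <= nth 0 mu i.
Proof. exact: part_nth_leq. Qed.

Let nth_block i r : nth 0 (drop (nth 0 mu i - nth 0 mu i.+1) (occ w i.+1)) r =
  nth 0 (occ w i.+1) (nth 0 mu i - nth 0 mu i.+1 + r).
Proof. by rewrite nth_drop. Qed.

Let size_block i :
  size (drop (nth 0 mu i - nth 0 mu i.+1) (occ w i.+1)) = nth 0 mu i.+1.
Proof. by rewrite size_drop size_occ'; have := mu_leq i; lia. Qed.

Let nth_occ_neq i j a b : a < size (occ w i) -> b < size (occ w j) ->
  nth 0 (occ w i) a = nth 0 (occ w j) b -> i = j.
Proof.
move=> ha hb e; have := mem_nth 0 ha; have := mem_nth 0 hb.
by rewrite -e !mem_occ => /andP[_ /eqP <-] /andP[_ /eqP ->].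
Qed.

(** The Yamanouchi inequality need only be tested on suffixes that start at an occurrence of the
    larger letter, where it compares occurrences of the two letters numbered from the last. *)
Lemma yam_good : 
  (forall i k, 0 < i -> count_mem i.+1 (drop k w) <= count_mem i (drop k w)) /\
  ~ jams delta w <->
  forall i, i.+1 < size mu ->
    good (pistoled delta) (drop (nth 0 mu i - nth 0 mu i.+1) (occ w i.+1)) (occ w i.+2).
Proof.
split=> [[yam jam] i hi|gd].
  have mi := mu_leq i.
  split.
  - exact: drop_sorted (occ_sorted _ _).
  - exact: occ_sorted.
  - move=> r; rewrite size_block nth_block => hr.
    set k := nth 0 (occ w i.+2) r; set a := nth 0 mu i in mi *;
      set m := nth 0 mu i.+1 in mi hr *.
    (* The suffix starting at this occurrence of [i.+2] contains [m - r] of them, hence at least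
       [m - r] letters [i.+1]. *)
    have := yam i.+1 k isT; rewrite !count_occ => le.
    have lt1 : m - r.+1 < count (leq k) (occ w i.+2).
      rewrite count_geq_sorted ?occ_sorted // size_occ' -/m; last by lia.
      by have -> : m - (m - r.+1).+1 = r by lia.
    have : m - r.+1 < count (leq k) (occ w i.+1) by apply: leq_trans le.
    rewrite count_geq_sorted ?occ_sorted // size_occ' -/a; last by lia.
    have -> : a - (m - r.+1).+1 = a - m + r by lia.
    (* Two different letters cannot share a position, so the inequality is strict. *)
    rewrite leq_eqVlt => /orP[/eqP e|//].
    suff : i.+2 = i.+1 by lia.
    by apply: nth_occ_neq e; rewrite size_occ' // -/a; lia.
  - move=> r; rewrite size_block nth_block => hr; apply/negP => hP; apply: jam.
    set a := nth 0 mu i in mi hP; set m := nth 0 mu i.+1 in mi hr hP.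
    (* Numbered from the last, t_(r+1) is occurrence [m - r.+1] of its letter and y_r is occurrence
       [(m - r.+1).+1] of the next letter. *)
    exists i.+1, (m - r.+1); rewrite !w_count //= -/a -/m; split=> //; try lia.
    rewrite /pos_from_last -!/(occ _ _) !nth_rev ?size_occ' -/a -/m /=; try lia.
    have -> : a - (m - r.+1).-1.+1 = a - m + r.+1 by lia.
    have -> : m - (m - r.+1).+1 = r by lia.
    by apply: pistoled_subset hP => x; rewrite !inE orbC.
split.
  move=> [//|i] k _; rewrite !count_occ.
  (* Past the length of [mu] the larger letter does not occur, its count being the default value
     0. *)
  have [hi|hi] := ltnP i.+1 (size mu); last first.
    rewrite leqNgt; apply/negP => lt.
    have := leq_ltn_trans (leq0n _) lt => {}lt.
    have := leq_trans lt (count_size _ _); rewrite size_occ' nth_default //.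
  have [s1 s2 g3 g4] := gd i hi; have mi := mu_leq i.
  case E: (count (leq k) (occ w i.+2)) => [//|j].
  have hj : j < nth 0 mu i.+1.
    by rewrite -size_occ' -E count_size.
  have : j < count (leq k) (occ w i.+2) by rewrite E.
  rewrite !count_geq_sorted ?occ_sorted ?size_occ' //; last by lia.
  move=> le; have := g3 (nth 0 mu i.+1 - j.+1); rewrite size_block nth_block => lt.
  have -> : nth 0 mu i - j.+1 = nth 0 mu i - nth 0 mu i.+1 + (nth 0 mu i.+1 - j.+1) by
    lia.
  by apply: leq_trans le (ltnW (lt _)); lia.
case=> [[|i]] [j [// _ j0]]; rewrite !w_count //= => ja jm.
have hi : i.+1 < size mu.
  by rewrite ltnNge; apply: contraL jm => /(nth_default 0) ->.
have [_ _ _ g4] := gd i hi; have mi := mu_leq i.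
rewrite /pos_from_last -!/(occ _ _) !nth_rev ?size_occ' //=; try lia.
have := g4 (nth 0 mu i.+1 - j.+1); rewrite size_block nth_block => /(_ _)/negP g hP.
apply: g; first by lia.
have -> : nth 0 mu i - nth 0 mu i.+1 + (nth 0 mu i.+1 - j.+1).+1 = nth 0 mu i - j.-1.+1
  by lia.
by apply: pistoled_subset hP => x; rewrite !inE orbC.
Qed.

End YamWord.

Section SYamPositions.
Variables (n : nat) (delta : diagram) (mu : seq nat).
Hypothesis size_delta : #|` delta|%fset = n.
Hypothesis mu_part : is_part mu.

Lemma Yam_letters w : Yam mu w -> {in w, forall a, a <= size mu}.
Proof.
case=> w0 wc _ [|a] aw //; rewrite ltnNge.
have : 0 < count_mem a.+1 w by rewrite -has_count has_pred1.
by rewrite wc //; apply: contraL => /(nth_default 0) ->.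
Qed.

Lemma Yam_sumn w : Yam mu w -> sumn mu = size w.
Proof.
move=> yw; have [w0 wc _] := yw.
have : count (fun b => b <= size mu) w = size w.
  by apply/eqP; rewrite -all_count; apply/allP/Yam_letters.
rewrite -sumn_count_mem // => <-; congr sumn.
apply: (@eq_from_nth _ 0) => [|i hi]; first by rewrite size_map size_iota.
by rewrite (nth_map 0) ?size_iota // nth_iota // wc.
Qed.

Lemma SYam_sumn u : SYam delta mu u -> sumn mu = n.
Proof. by case=> w [/Yam_sumn -> -> _]. Qed.

(** One way, the list of positions of a standardization cuts into the occurrences of each letter;
    the other way, [block_word] supplies the word. *)
Lemma SYam_positions u : sumn mu = n -> perm_word n u ->
  SYam delta mu u <-> yam_positions (pistoled delta) mu (positions u).
Proof.
move=> smu pu; split.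
  case=> w [yw sw jam] eu; have [w0 wc yam] := yw.
  have re : reshape mu (positions u) = [seq occ w a | a <- iota 1 (size mu)].
    rewrite eu (positions_standardize w0 (Yam_letters yw)) -[RHS]flattenK;
      congr reshape.
    apply: (@eq_from_nth _ 0) => [|i hi]; first by rewrite !size_map size_iota.
    by rewrite (nth_map [::]) ?size_map ?size_iota // (nth_map 0) ?size_iota //
      nth_iota // size_occ wc.
  have blk i : i < size mu -> nth [::] (reshape mu (positions u)) i = occ w i.+1.
    by move=> hi; rewrite re (nth_map 0) ?size_iota // nth_iota.
  split=> i.
    have [hi|hi] := ltnP i (size mu); first by rewrite blk // occ_sorted.
    by rewrite nth_default ?size_reshape.
  move=> hi; rewrite !blk //; last by apply: ltnW.
  by apply: (proj1 (yam_good mu_part wc sw)) hi; split.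
case=> srt gd; have blk := occ_block_word smu pu srt.
exists (block_word mu u); last by rewrite (standardize_block_word smu pu srt).
have szw : size (block_word mu u) = #|` delta|%fset.
  by rewrite size_map (perm_word_size pu).
have wc i : 0 < i -> count_mem i (block_word mu u) = nth 0 mu i.-1.
  case: i => // i _; rewrite -size_occ blk /= -nth_shape reshapeKl //.
  by rewrite size_positions (perm_word_size pu) smu.
have [|yam jam] := proj2 (yam_good mu_part wc szw).
  by move=> i hi; rewrite !blk; apply: gd.
by split=> //; split=> //; apply: block_word_gt0.
Qed.

End SYamPositions.

(** * Invariance under isomorphism *)

Section Transfer.
Variables (P P' : pred (seq nat)) (G H : scgraph).
Variables (L : G -> seq nat) (L' : H -> seq nat) (f : G -> H) (mu : seq nat).
Hypothesis subP : subset_closed P.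
Hypothesis convP : convex P.
Hypothesis subP' : subset_closed P'.
Hypothesis convP' : convex P'.
Hypothesis mL : model P L.
Hypothesis mL' : model P' L'.
Hypothesis bij_f : bijective f.
Hypothesis sig_f : forall v, signature (f v) = signature v :> seq bool.
Hypothesis edge_f : forall i u v, edge i (f u) (f v) = edge i u v.
Hypothesis mu_part : is_part mu.
Hypothesis deg_G : degree G = sumn mu.
Hypothesis deg_H : degree H = sumn mu.

Lemma sumn_take_leq i : sumn (take i mu) <= sumn mu.
Proof. by rewrite -{2}(cat_take_drop i mu) sumn_cat leq_addr. Qed.

Lemma sumn_takeS i : sumn (take i.+1 mu) = sumn (take i mu) + nth 0 mu i.
Proof.
have [hi|hi] := ltnP i (size mu); first by rewrite (take_nth 0) // sumn_rcons.
by rewrite nth_default // !take_oversize // ?addn0 // leqW.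
Qed.

Lemma sorted_interval k m q : k + m <= size q ->
  sorted ltn (take m (drop k q)) <->
  (forall r, r.+1 < m -> nth 0 q (k + r) < nth 0 q (k + r).+1).
Proof.
move=> h; have sz : size (take m (drop k q)) = m by rewrite size_takel // size_drop;
  lia.
split=> [/(sortedP 0) s r hr|s].
  by have := s r; rewrite sz !nth_take ?nth_drop ?addnS //; [apply|apply: ltnW].
apply/(sortedP 0) => r; rewrite sz => hr.
by rewrite !nth_take ?nth_drop ?addnS //; [apply: s|apply: ltnW].
Qed.

(** Increasing blocks are read from the signature, and each [good] condition is a [mixable] one;
    both pass through the isomorphism although [P] becomes [P']. *)
Lemma yam_positions_iso v : yam_positions P mu (L v) -> yam_positions P' mu (L' (f v)).
Proof.
move=> [srt gd]; split=> i.
  have := srt i; rewrite !nth_reshape.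
  have := sumn_take_leq i.+1; rewrite sumn_takeS => le.
  move/sorted_interval => h; apply/sorted_interval;
    first by rewrite (model_size mL') deg_H.
  move=> r hr; rewrite -(model_sig mL') ?sig_f ?(model_sig mL); try lia.
  by apply: h => //; rewrite (model_size mL) deg_G.
move=> hi; move: (gd i hi); rewrite !nth_reshape sumn_takeS.
have := part_nth_leq mu_part (leqnSn i).
have := sumn_take_leq i.+2; rewrite !sumn_takeS.
set s := sumn _; set a := nth 0 mu i; set m := nth 0 mu i.+1 => le ma.
(* The last [m] entries of the block of length [a] are adjacent to the next block, so [mixable]
   applies from index [s + (a - m)]. *)
have e q : drop (a - m) (take a (drop s q)) = take m (drop (s + (a - m)) q).
  by rewrite -{2}(subnKC ma) -take_drop drop_drop addnC.
rewrite !e; have -> : s + a = s + (a - m) + m by lia.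
move/(mixableP subP convP mL _) => h; apply/(mixableP subP' convP' mL').
  by rewrite deg_H; lia.
by apply: mixable_iso => //; apply: h; rewrite deg_G; lia.
Qed.

End Transfer.

(** * The superstandard tableau *)

Definition row_word (la : seq nat) : seq nat :=
  [seq `|(val c).2|%N.+1 | c <- cells (young_diagram la)].

Lemma size_row_word la : size (row_word la) = sumn la.
Proof. by rewrite size_map size_cells size_young. Qed.

Lemma row_word_gt0 la : 0 \notin row_word la.
Proof. by apply/mapP => -[]. Qed.

Lemma nth_row_word la (c : young_diagram la) :
  nth 0 (row_word la) (index c (cells _)) = `|(val c).2|%N.+1.
Proof. by rewrite (nth_map c) ?nth_index ?index_mem ?mem_cells. Qed.

Lemma count_row_word la i : count_mem i.+1 (row_word la) = nth 0 la i.
Proof.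
rewrite count_map -size_filter -(size_map val).
rewrite -[RHS](size_iota 0) -[RHS](size_map (fun x => (Posz x, Posz i) : cell)).
apply/perm_size/uniq_perm.
- by rewrite map_inj_uniq ?filter_uniq ?uniq_cells //; apply: val_inj.
- by rewrite map_inj_uniq ?iota_uniq // => x y [].
move=> c; apply/mapP/mapP => [[d]|[x]].
  rewrite mem_filter /= => /andP[/eqP [di] _] ->.
  have /mem_young [x [y [e h]]] := valP d.
  move: di; rewrite e /= => yi; exists x; rewrite ?mem_iota -?yi //.
rewrite mem_iota /= => hx ->.
have H : (Posz x, Posz i) \in young_diagram la by apply/mem_young; exists x, i.
by exists [` H]%fset; rewrite ?mem_filter ?mem_cells //= eqxx.
Qed.

Lemma part_eq la mu : is_part la -> is_part mu -> nth 0 la =1 nth 0 mu -> la = mu.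
Proof.
move=> /andP[_ la0] /andP[_ mu0] e.
have key s t : 0 \notin s -> nth 0 s =1 nth 0 t -> size s <= size t.
  move=> s0 est; rewrite leqNgt; apply: contra s0 => lt.
  by rewrite -[0](nth_default 0 (leqnn (size t))) -est mem_nth.
apply: (@eq_from_nth _ 0) => [|i _]; last exact: e.
by apply/eqP; rewrite eqn_leq !key // => i; rewrite e.
Qed.

Section Tableau.
Variable la : seq nat.
Hypothesis la_part : is_part la.
Local Notation Y := (young_diagram la).

Section Uniqueness.
Variables (T : SYT la) (mu : seq nat).
Hypothesis mu_part : is_part mu.
Hypothesis sumn_mu : sumn mu = sumn la.
Let u := reading_word (val T).
Hypothesis yam_T : yam_positions xpred0 mu (positions u).
Let pu : perm_word (sumn la) u := SYT_perm_word T.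
Let srt := proj1 yam_T.
Let block (c : Y) := reshape_index mu (val T c).-1.

Let block_leq c d : val T c <= val T d -> block c <= block d.
Proof.
move=> h; have : (val T c).-1 <= (val T d).-1 by lia.
rewrite (reshape_leq mu) -/(block c) -/(block d).
by case/orP => [/ltnW//|/andP[/eqP-> _]].
Qed.

Let block_index c d : val T c < val T d -> block c = block d ->
  index c (cells Y) < index d (cells Y).
Proof.
move=> lt e; rewrite -!(SYT_index T) -/u.
have su := perm_word_size pu; have hc := SYT_bound T c; have hd := SYT_bound T d.
have flat : flatten (reshape mu (positions u)) = positions u.
  by apply: reshapeKr; rewrite size_positions su sumn_mu.
have shp : shape (reshape mu (positions u)) = mu.
  by apply: reshapeKl; rewrite size_positions su sumn_mu.
have idx (x : Y) : index (val T x : nat) u =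
    nth 0 (nth [::] (reshape mu (positions u)) (block x)) (reshape_offset mu (val T
      x).-1).
  have hx := SYT_bound T x.
  rewrite -[X in index X _]prednK; last by case/andP: hx.
  rewrite -nth_positions ?su; last by lia.
  by rewrite -{1}flat nth_flatten shp.
rewrite !idx e; apply: (sorted_ltn_nth ltn_trans 0 (srt (block d))).
- rewrite inE -nth_shape shp -e; apply: reshape_offsetP; rewrite sumn_mu; lia.
- rewrite inE -nth_shape shp; apply: reshape_offsetP; rewrite sumn_mu; lia.
have : (val T c).-1 < (val T d).-1 by lia.
by rewrite ltnNge (reshape_leq mu) -/(block c) -/(block d) e ltnn eqxx /= -ltnNge.
Qed.

(** The inequality y_r < t_r of [good] provides, for each label of block [i.+1], a label of block
    [i] that is read later. *)
Let block_later c i : block c = i.+1 ->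
  exists2 d, block d = i & index c (cells Y) < index d (cells Y).
Proof.
move=> bc; have su := perm_word_size pu.
have hb x : block x < size mu.
  by apply: reshape_indexP; rewrite sumn_mu; have := SYT_bound T x; lia.
have hi : i.+1 < size mu by rewrite -bc hb.
have nthb x : nth 0 (block_word mu u) (index x (cells Y)) = (block x).+1.
  rewrite (nth_map 0) ?size_map ?index_mem ?mem_cells //.
  by rewrite (nth_map x) ?index_mem ?mem_cells // nth_index ?mem_cells.
have ltn_idx (x : Y) : index x (cells Y) < sumn la.
  by rewrite -size_young -size_cells index_mem mem_cells.
have : index c (cells Y) \in nth [::] (reshape mu (positions u)) i.+1.
  by rewrite (mem_block sumn_mu pu) // ltn_idx nthb bc eqxx.
case/(nthP 0) => r hr er; have [_ _ g3 _] := proj2 yam_T i hi.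
have szb j : size (nth [::] (reshape mu (positions u)) j) = nth 0 mu j.
  by rewrite -nth_shape reshapeKl // size_positions su sumn_mu.
have := part_nth_leq mu_part (leqnSn i) => mi.
have hr' : r < size (drop (nth 0 mu i - nth 0 mu i.+1) (nth [::] (reshape mu (positions
  u)) i)).
  by rewrite szb in hr; rewrite size_drop szb; lia.
have := g3 r hr'; rewrite er; set p := nth 0 (drop _ _) r => lt.
have : p \in nth [::] (reshape mu (positions u)) i.
  by apply: (mem_drop (mem_nth 0 hr')).
rewrite (mem_block sumn_mu pu) ?(ltnW hi) // => /andP[hp /eqP ep].
have hpc : p < size (cells Y) by rewrite size_cells size_young.
have ip : index (nth c (cells Y) p) (cells Y) = p by rewrite index_uniq // uniq_cells.
exists (nth c (cells Y) p); last by rewrite ip.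
by have := nthb (nth c (cells Y) p); rewrite ip ep => -[].
Qed.

(* Columns increase strictly, so the block number of a label is at least its row
   number; the Yamanouchi condition gives the other inequality. *)
Lemma block_row c : (val c).2 = Posz (block c).
Proof.
have le1 y d : (val d).2 = Posz y -> y <= block d.
  elim: y d => [//|y IH] d dy.
  have g := young_ge0 d.
  have [e ee] : exists e : Y, val e = ((val d).1, Posz y).
    apply: (young_down la_part (c := d)); last by rewrite dy; lia.
    by case/andP: g => -> _; rewrite Order.POrderTheory.lexx.
  have ye : y <= block e by apply: IH; rewrite ee.
  have lt : val T e < val T d by apply: SYT_col; rewrite ee //= dy ltz_nat.
  have le := block_leq (ltnW lt).
  (* Within one block the smaller label is read first, but [e] lies in the row below [d] and is read
     after it. *)
  have [eq|ne] := eqVneq (block e) (block d); last by lia.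
  have := block_index lt eq; rewrite index_cells_lt /row_order ee dy /=; lia.
have le2 i d : block d = i -> (Posz i <= (val d).2)%R.
  elim: i d => [d _|i IH d bd]; first by have /andP[] := young_ge0 d.
  have [e be lt] := block_later bd; have := IH e be.
  move: lt; rewrite index_cells_lt /row_order => h ie.
  (* Otherwise [d] lies in the row of [e], to its left, so its label is smaller although its block
     is later. *)
  have [//|hd] := boolP (Posz i.+1 <= (val d).2)%R.
  have [e1 e2] : (val d).2 = (val e).2 /\ ((val d).1 < (val e).1)%R.
    by move: h ie hd; case: (val d) => xd yd; case: (val e) => xe ye /=; lia.
  have := block_leq (ltnW (SYT_row T e1 e2)); rewrite be bd; lia.
have := young_ge0 c; have := le2 _ c erefl.
case E: (val c).2 => [y|y] //; have := le1 y c E; by move=> h1 h2 _; congr Posz; lia.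
Qed.

Lemma block_word_row : block_word mu u = row_word la.
Proof.
rewrite /block_word /u /reading_word -map_comp; apply: eq_map => c /=.
by rewrite block_row.
Qed.

Lemma yam_shape : mu = la.
Proof.
apply: part_eq => // i.
rewrite -[RHS]count_row_word -block_word_row -size_occ (occ_block_word sumn_mu pu) //.
by rewrite -nth_shape reshapeKl // size_positions (perm_word_size pu) sumn_mu.
Qed.

(** The word behind the labels has in each cell its row number, counted from 1, and its
    standardization gives the labels back. *)
Lemma yam_reading_word : u = standardize (row_word la).
Proof. by rewrite -block_word_row (standardize_block_word sumn_mu pu srt). Qed.

End Uniqueness.

Let w := row_word la.
Let u0 := standardize w.

Let row_lt i (c : Y) : `|(val c).2|%N = i -> i < size la.
Proof.
have /mem_young [x [y [-> h]]] := valP c => <- /=.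
by rewrite ltnNge; apply: contraL h => /(nth_default 0) ->.
Qed.

Let row_word_le : {in w, forall a, a <= size la}.
Proof. by move=> _ /mapP[c _ ->]; apply: row_lt. Qed.

Let pu0 : perm_word (sumn la) u0.
Proof. by rewrite -size_row_word;
  apply: (standardize_perm_word (row_word_gt0 la) row_word_le). Qed.

Let reshape_u0 i : nth [::] (reshape la (positions u0)) i = occ w i.+1.
Proof.
rewrite (positions_standardize (row_word_gt0 la) row_word_le).
have shp : la = shape [seq occ w a | a <- iota 1 (size la)].
  apply: (@eq_from_nth _ 0) => [|j hj]; first by rewrite !size_map size_iota.
  by rewrite (nth_map [::]) ?size_map ?size_iota // (nth_map 0) ?size_iota //
    nth_iota // size_occ count_row_word.
rewrite [X in reshape X _]shp flattenK.
have [hi|hi] := ltnP i (size la).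
  by rewrite (nth_map 0) ?size_iota // nth_iota.
rewrite nth_default ?size_map ?size_iota //.
by apply/esym/eqP; rewrite -size_eq0 size_occ count_row_word nth_default.
Qed.

(** Letters [i.+2] fill the row just above that of the letters [i.+1], so they are all read earlier;
    with nothing pistoled, the last clause of [good] is immediate. *)
Let yam_u0 : yam_positions xpred0 la (positions u0).
Proof.
split=> i; first by rewrite reshape_u0 occ_sorted.
move=> hi; rewrite !reshape_u0; split=> //.
- exact: drop_sorted (occ_sorted _ _).
- exact: occ_sorted.
have le := part_nth_leq la_part (leqnSn i).
move=> r hr; move: (mem_drop (mem_nth 0 hr)).
move: hr; rewrite size_drop size_occ count_row_word => hr.
have hr' : r < size (occ w i.+2) by rewrite size_occ count_row_word; lia.
move: (mem_nth 0 hr'); rewrite !mem_occ size_row_word -size_young -size_cells.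
move: (nth 0 _ r) (nth 0 (drop _ _) r) => p q /andP[hp ep] /andP[hq eq].
have c0 : Y by case: (cells Y) hp => [|c0 _ _] //; exact: c0.
rewrite -(index_uniq c0 hp (uniq_cells _)) -(index_uniq c0 hq (uniq_cells _)).
move: ep eq;
  rewrite -{1}(index_uniq c0 hp (uniq_cells _)) -{1}(index_uniq c0 hq (uniq_cells _)).
rewrite !nth_row_word index_cells_lt /row_order.
have := young_ge0 (nth c0 (cells Y) p); have := young_ge0 (nth c0 (cells Y) q).
case: (val (nth c0 (cells Y) p)) => xp yp; case: (val (nth c0 (cells Y) q)) => xq yq /=.
lia.
Qed.

Let standardize_lt p q : p < size w -> q < size w ->
  (nth 0 w p < nth 0 w q) || ((nth 0 w p == nth 0 w q) && (p < q)) ->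
  nth 0 u0 p < nth 0 u0 q.
Proof.
move=> hp hq; rewrite !(nth_map 0) ?size_iota // !nth_iota // !add0n.
set a := nth 0 w p; set b := nth 0 w q.
rewrite !(take_nth 0) // -/a -/b -!cats1 !count_cat /= !eqxx !addn0 !addn1.
case/orP => [ab|/andP[/eqP <- pq]]; last first.
  have -> : take q w = take p.+1 w ++ take (q - p.+1) (drop p.+1 w).
    by rewrite -takeD subnKC.
  by rewrite count_cat (take_nth 0) // -/a -cats1 count_cat /= eqxx; lia.
have h1 : (count_mem a (take p w)).+1 <= count_mem a w.
  by rewrite -[in X in _ <= X](cat_take_drop p w) count_cat (drop_nth 0) //= -/a eqxx;
    lia.
have h2 : count (fun x => x < a) w + count_mem a w <= count (fun x => x < b) w.
  rewrite -(count_predUI (fun x => x < a)).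
  rewrite (@eq_count _ (predI _ _) pred0) ?count_pred0 ?addn0; last by move=> x /=; lia.
  by apply: sub_count => x /=; lia.
apply: leq_ltn_trans (leq_trans (leq_add (leqnn _) h1) h2) _.
by rewrite addnS ltnS leq_addr.
Qed.

(** Filling the cells with the standardized row word puts smaller labels in lower rows and increases
    along each row. *)
Lemma superstandard : exists T : SYT la,
  reading_word (val T) = standardize (row_word la) /\
  yam_positions xpred0 la (positions (reading_word (val T))).
Proof.
have su := perm_word_size pu0.
have sY : size (cells Y) = sumn la by rewrite size_cells size_young.
have idx (c : Y) : index c (cells Y) < size w.
  by rewrite size_row_word -sY index_mem mem_cells.
pose T : filling la := [ffun c => inord (nth 0 u0 (index c (cells Y)))].
have vT c : T c = nth 0 u0 (index c (cells Y)) :> nat.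
  rewrite ffunE inordK //.
  have : nth 0 u0 (index c (cells Y)) \in u0 by rewrite mem_nth ?su -?size_row_word.
  by rewrite (perm_word_mem _ pu0); lia.
have rw : reading_word T = u0.
  apply: (@eq_from_nth _ 0); rewrite size_map sY ?su // => p hp.
  have c0 : Y by case: (cells Y) sY hp => [/= <-|c0] //.
  by rewrite (nth_map c0) ?sY // vT index_uniq ?sY // uniq_cells.
suff sT : is_SYT T by exists (exist _ T sT); rewrite /= rw; split=> //; exact: yam_u0.
apply/and3P; split; first by rewrite rw.
  apply/forallP => c; apply/forallP => c'; apply/implyP => /andP[/eqP er lt].
  rewrite !vT; apply: standardize_lt => //; rewrite !nth_row_word er eqxx ltnn /=.
  by rewrite index_cells_lt /row_order er eqxx Order.POrderTheory.ltxx /=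
    -Order.TotalTheory.ltNge.
apply/forallP => c; apply/forallP => c'; apply/implyP => /andP[/eqP er lt].
rewrite !vT; apply: standardize_lt => //; rewrite !nth_row_word; apply/orP; left.
have := young_ge0 c; have := young_ge0 c'; move: lt.
case: (val c) => x y; case: (val c') => x' y' /=; lia.
Qed.

End Tableau.

Theorem theorem1p2 (n : nat) (delta : diagram) (hn : #|` delta|%fset = n)
    (la : seq nat) (hla : part_of n la)
    (V : {set 'S_(#|` delta|%fset)})
    (hV : is_component (G := assaf_graph delta) V)
    (hdeg : dual_equivalence_graph (induced (G := assaf_graph delta) V))
    (hiso : isomorphic (induced (G := assaf_graph delta) V) (standard_graph la)) :
  (exists! s, s \in V /\ SYam delta la (one_line s)) /\
  (forall mu : seq nat, is_part mu -> mu <> la ->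
     forall s, s \in V -> ~ SYam delta mu (one_line s)).
Proof.
have /andP[la_part /eqP sla] := hla.
have [f bij_f [sig_f edge_f]] := hiso.
have mG := component_model hV; have mH := standard_model la_part.
have subH : subset_closed xpred0 by [].
have convH : convex xpred0 by [].
have subG := @pistoled_subset delta; have convG := @pistoled_convex delta.
have pw (s : 'S_(#|` delta|%fset)) : perm_word n (one_line s).
  by rewrite -[in X in perm_word X]hn; apply: one_line_perm_word.
(* In the standard graph nothing is pistoled, so the transported condition forces both the shape and
   the tableau. *)
have key s (sV : s \in V) mu : is_part mu -> SYam delta mu (one_line s) ->
    mu = la /\ reading_word (val (f (exist _ s sV))) = standardize (row_word la).
  move=> mu_part ys; have smu := SYam_sumn hn ys.
  have /(SYam_positions hn mu_part smu (pw s)) yp := ys.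
  have := yam_positions_iso subG convG subH convH mG mH bij_f sig_f edge_f mu_part.
  rewrite smu => /(_ hn sla (exist _ s sV) yp) yT.
  by split; [apply: yam_shape yT|apply: yam_reading_word yT]; rewrite ?smu ?sla.
split; last by move=> mu mu_part ne s sV /(key s sV mu mu_part) [].
(* Existence: the inverse isomorphism carries the superstandard tableau back into [V]. *)
have [T [rT yT]] := superstandard la_part.
have [g fK gK] := bij_f.
have := yam_positions_iso subH convH subG convG mH mG (Bijective gK fK).
have sig_g v : signature (g v) = signature v :> seq bool by rewrite -sig_f gK.
have edge_g i a b : edge i (g a) (g b) = edge i a b by rewrite -edge_f !gK.
move=> /(_ la sig_g edge_g la_part erefl (etrans hn (esym sla)) T yT).
case egT: (g T) => [s sV] /= yp.
exists s; split.
  by split=> //; apply/(SYam_positions hn la_part sla (pw s)).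
(* Uniqueness: every such vertex has the superstandard tableau as its image, and [f] is
   injective. *)
move=> s' [s'V ys'].
have [_ e] := key s' s'V la la_part ys'.
have : f (exist _ s' s'V) = T by apply: reading_word_inj; rewrite e rT.
by move/(congr1 g); rewrite fK egT => /(congr1 val).
Qed.
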